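(* Let $G$ be a Lie group with identity $e$ and Lie algebra $\mathfrak{g}$, and let $\epsilon\in\{1,-1\}$. (1) If $\mathfrak{D}:G\to G$ is a smooth map which is the inverse of a Rota-Baxter operator of weight $\epsilon$ on $G$, then $\mathfrak{D}$ is a differential operator of weight $\epsilon$ on $G$. (2) Let $(G,\mathfrak{D})$ be a differential Lie group of weight $\epsilon$, and let $D=\mathfrak{D}_{*e}:\mathfrak{g}\to\mathfrak{g}$ be the tangent map of $\mathfrak{D}$ at $e$. Then $(\mathfrak{g},D)$ is a differential Lie algebra of weight $\epsilon$.
   Context: For a group $G$, $\mathrm{Ad}_g h:=ghg^{-1}$. A Rota-Baxter operator of weight $1$ on a Lie group $G$ is a smooth map $\mathfrak{B}:G\to G$ with $\mathfrak{B}(g_1)\mathfrak{B}(g_2)=\mathfrak{B}(g_1\,\mathrm{Ad}_{\mathfrak{B}(g_1)}g_2)$ for all $g_1,g_2\in G$; a Rota-Baxter operator of weight $-1$ is a smooth map $\mathfrak{C}:G\to G$ with $\mathfrak{C}(g_1)\mathfrak{C}(g_2)=\mathfrak{C}((\mathrm{Ad}_{\mathfrak{C}(g_1)}g_2)g_1)$ for all $g_1,g_2\in G$. A differential operator of weight $1$ (resp. $-1$) on a Lie group $G$ is a smooth map $\mathfrak{D}:G\to G$ with $\mathfrak{D}(gh)=\mathfrak{D}(g)\,\mathrm{Ad}_g\mathfrak{D}(h)$ (resp. $\mathfrak{D}(gh)=(\mathrm{Ad}_g\mathfrak{D}(h))\,\mathfrak{D}(g)$) for all $g,h\in G$; then $(G,\mathfrak{D})$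 is called a differential Lie group of weight $1$ (resp. $-1$), and one has $\mathfrak{D}(e)=e$. A differential Lie algebra of weight $\lambda$ is a Lie algebra $(\mathfrak{g},[\cdot,\cdot]_{\mathfrak{g}})$ with a linear map $D:\mathfrak{g}\to\mathfrak{g}$ such that $D[u,v]_{\mathfrak{g}}=[D(u),v]_{\mathfrak{g}}+[u,D(v)]_{\mathfrak{g}}+\lambda[D(u),D(v)]_{\mathfrak{g}}$ for all $u,v\in\mathfrak{g}$. *)

(* Defs.v *)
From HB Require Import structures.
From mathcomp Require Import all_boot all_order all_algebra.
From mathcomp Require Import all_classical all_reals all_analysis.
From mathcomp Require Import ring.

Set Implicit Arguments.
Unset Strict Implicit.
Unset Printing Implicit Defensive.

Import Order.TTheory GRing.Theory Num.Theory.
Import numFieldNormedType.Exports.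

Local Open Scope classical_set_scope.
Local Open Scope ring_scope.

(* Only used for open A, so that the derivatives at a point of A depend only
   on the values of f on A. *)
Fixpoint Ck {R : realType} {V W : normedModType R} (k : nat) (A : set V)
    (f : V -> W) : Prop :=
  if k is k'.+1 then
    (forall x, A x -> differentiable f x) /\ (forall v : V, Ck k' A ('D_v f))
  else forall x, A x -> {for x, continuous f}.

Definition smooth_on {R : realType} {V W : normedModType R} (A : set V)
    (f : V -> W) : Prop := forall k, Ck k A f.

Section SmoothCalculus.
Context {R : realType}.
Implicit Types V W : normedModType R.

Lemma Ck_pointwise V W k (A : set V) (f : V -> W) :
  Ck k A f <-> forall x, A x -> Ck k [set x] f.
Proof.
elim: k f => [|k IH] f /=.
  by split=> [Hf x Ax y ->|Hf x Ax]; [exact: Hf|exact: (Hf x Ax x)].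
split=> [[df Df] x Ax|Hf].
  split=> [y ->|v]; first exact: df.
  by have /IH := Df v; apply.
split=> [x Ax|v]; first by have [+ _] := Hf x Ax; exact.
by apply/IH => x Ax; have [_] := Hf x Ax; exact.
Qed.

Lemma near0_differentiable V W (x : V) (h : V -> W) :
  (\near x, h x = 0) -> differentiable h x.
Proof.
move=> h0; pose z : {linear V -> W} := \0.
have zc : continuous z by move=> y; exact: cvg_cst.
have E : h \o shift x = cst (h x) + z +o_ 0 id.
  apply/eqaddoP => _ /posnumP[e]; near=> y.
  rewrite -[X in `|X|]/(h (y + x) - (h x + 0)) (nbhs_singleton h0).
  rewrite (_ : h (y + x) = 0) ?addr0 ?subr0 ?normr0 ?mulr_ge0 //.
  near: y; have := h0; rewrite (near_shift 0) /=.
  by apply: filterS => y /=; rewrite subr0.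
have dE := diff_unique zc E.
by apply/diff_locallyP; rewrite dE.
Unshelve. all: by end_near. Qed.

Lemma near_eq_differentiable V W (x : V) (f g : V -> W) :
  (\near x, f x = g x) -> differentiable f x -> differentiable g x.
Proof.
move=> fg df; rewrite (_ : g = f + (g - f)); last by rewrite addrC subrK.
apply: differentiableD => //; apply: near0_differentiable.
by apply: filterS fg => y fgy; rewrite !fctE fgy subrr.
Qed.

Lemma Ck_near_eq V W k (x : V) (f g : V -> W) :
  (\near x, f x = g x) -> Ck k [set x] f -> Ck k [set x] g.
Proof.
elim: k f g => [|k IH] f g fg /=.
  move=> Hf _ ->; have := Hf x erefl.
  rewrite /prop_for /continuous_at -(nbhs_singleton fg).
  by apply: cvg_trans; exact: near_eq_cvg.
move=> [df Df]; split=> [_ ->|v].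
  exact: near_eq_differentiable fg (df x erefl).
apply: IH (Df v); move: fg; rewrite -!nbhs_nearE => /nbhs_interior.
by apply: filterS => y /near_eq_derive.
Qed.

Lemma Ck_eq V W k (A : set V) (f g : V -> W) : open A ->
  (forall x, A x -> f x = g x) -> Ck k A f -> Ck k A g.
Proof.
move=> oA fg /Ck_pointwise cf; apply/Ck_pointwise => x Ax.
apply: Ck_near_eq (cf x Ax).
by have := open_nbhs_nbhs (conj oA Ax); apply: filterS; exact: fg.
Qed.

Lemma Ck_sub V W k (A B : set V) (f : V -> W) :
  A `<=` B -> Ck k B f -> Ck k A f.
Proof. by move=> AB /Ck_pointwise Bf; apply/Ck_pointwise => x /AB /Bf. Qed.

Lemma CkW V W k (A : set V) (f : V -> W) : Ck k.+1 A f -> Ck k A f.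
Proof.
elim: k f => [|k IH] f [df Df].
  by move=> x Ax; exact/differentiable_continuous/df.
by split=> // v; exact/IH/Df.
Qed.

Lemma Ck_cst V W k (A : set V) (c : W) : Ck k A (cst c).
Proof.
elim: k c => [|k IH] c /=; first by move=> x _; exact: cst_continuous.
split=> [x _|v]; first exact: differentiable_cst.
rewrite (_ : 'D_v _ = cst 0) //; apply/funext => x; exact: derive_cst.
Qed.

Lemma CkD V W k (A : set V) (f g : V -> W) : open A ->
  Ck k A f -> Ck k A g -> Ck k A (f + g).
Proof.
move=> oA; elim: k f g => [|k IH] f g /=.
  by move=> cf cg x Ax; apply: continuousD; [exact: cf|exact: cg].
move=> [df Df] [dg Dg]; split=> [x Ax|v].
  by apply: differentiableD; [exact: df|exact: dg].
apply: Ck_eq (IH _ _ (Df v) (Dg v)) => // x Ax.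
by rewrite deriveD //; apply: diff_derivable; [exact: df|exact: dg].
Qed.

Lemma CkM V k (A : set V) (f g : V -> R) : open A ->
  Ck k A f -> Ck k A g -> Ck k A (f * g).
Proof.
move=> oA; elim: k f g => [|k IH] f g.
  by move=> cf cg x Ax; apply: continuousM; [exact: cf|exact: cg].
move=> cf cg; have [df Df] := cf; have [dg Dg] := cg.
split=> [x Ax|v].
  by apply: differentiableM; [exact: df|exact: dg].
have := CkD oA (IH _ _ (CkW cf) (Dg v)) (IH _ _ (CkW cg) (Df v)).
apply: Ck_eq => // x Ax.
by rewrite deriveM //; apply: diff_derivable; [exact: df|exact: dg].
Qed.

Lemma Ck_sum V k (A : set V) n (f : 'I_n -> V -> R) : open A ->
  (forall i, Ck k A (f i)) -> Ck k A (\sum_i f i).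
Proof.
move=> oA cf; elim/big_ind : _ => //; first exact: (@Ck_cst _ _ k A 0).
by move=> g h; exact: CkD.
Qed.

Lemma Ck_coord V k (A : set V) n (f : V -> 'rV[R]_n) j : open A ->
  Ck k A f -> Ck k A (fun x => f x ord0 j).
Proof.
move=> oA; elim: k f => [|k IH] f.
  move=> cf x Ax.
  apply: (@continuous_comp _ _ _ f (fun u : 'rV[R]_n => u ord0 j)).
    exact: cf.
  exact: coord_continuous.
move=> [df Df]; split=> [x Ax|v].
  have := differentiable_coord (f x) ord0 j.
  by apply: differentiable_comp; exact: df.
apply: Ck_eq (IH _ (Df v)) => // x Ax.
rewrite derive_mx ?mxE //; apply/diff_derivable; exact: df.
Qed.

Lemma Ck_comp V k n (A : set V) (B : set 'rV[R]_n)
    (h : V -> 'rV[R]_n) (f : 'rV[R]_n -> R) : open A ->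
  (forall x, A x -> B (h x)) ->
  Ck k B f -> Ck k A h -> Ck k A (f \o h).
Proof.
move=> oA AB; elim: k f => [|k IH] f.
  by move=> cf ch x Ax; apply: continuous_comp; [exact: ch|exact/cf/AB].
move=> cf ch; have [df Df] := cf; have [dh Dh] := ch.
split=> [x Ax|v].
  by apply: differentiable_comp; [exact: dh|exact/df/AB].
have : Ck k A (\sum_j ((fun x => ('D_v h x) ord0 j) *
                         ('D_(delta_mx ord0 j) f \o h))).
  apply: Ck_sum => // j; apply: CkM => //; first exact: (Ck_coord j oA (Dh v)).
  by apply: IH; [exact: Df|exact: CkW].
apply: Ck_eq => // x Ax.
have dfh : differentiable f (h x) by exact/df/AB.
rewrite deriveE; last by apply: differentiable_comp => //; exact: (dh x Ax).
have dhx := dh x Ax.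
rewrite diff_comp //= -(deriveE v dhx).
rewrite [X in _ = 'd f (h x) X]row_sum_delta linear_sum fct_sumE.
apply: eq_bigr => j _.
by rewrite linearZ /= -deriveE.
Qed.

Lemma Ck_comp_affine (U V W : normedModType R) k (A : set V) (B : set U)
    (h : V -> U) (L : V -> U) (f : U -> W) : open A ->
  (forall x, is_diff x h L) -> (forall x, A x -> B (h x)) ->
  Ck k B f -> Ck k A (f \o h).
Proof.
move=> oA dh AB; elim: k f => [|k IH] f.
  move=> cf x Ax; apply: continuous_comp; last exact/cf/AB.
  by apply: differentiable_continuous; have [] := dh x.
move=> [df Df].
have dhx x : differentiable h x by have [] := dh x.
have dhL x : 'd h x = L :> (V -> U) by have [] := dh x.
split=> [x Ax|v]; first by apply: differentiable_comp => //; exact/df/AB.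
apply: Ck_eq (IH _ (Df (L v))) => // x Ax /=.
have dfh : differentiable f (h x) by exact/df/AB.
rewrite (deriveE _ dfh) (deriveE _ (differentiable_comp (dhx x) dfh)).
by rewrite (diff_comp (dhx x) dfh) /= dhL.
Qed.

End SmoothCalculus.

(* Raw data: coord is meaningful on dom and param on crange, where they are
   inverse to each other; values elsewhere are junk. The laws are in
   chart_homeo and smooth_atlas. *)
Record chart (R : realType) (M : Type) (V : normedModType R) := Chart {
  dom : set M;
  coord : M -> V;
  param : V -> M }.

Definition crange {R : realType} {M : Type} {V : normedModType R}
  (c : chart M V) : set V := coord c @` dom c.

Definition prod_chart {R : realType} {M N : Type} {V W : normedModType R}
    (c : chart M V) (d : chart N W) : chart (M * N)%type (V * W)%type :=
  Chart (dom c `*` dom d) (fun p => (coord c p.1, coord d p.2))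
        (fun q => (param c q.1, param d q.2)).

Definition prod_atlas {R : realType} {M N : Type} {V W : normedModType R}
    (A : set (chart M V)) (B : set (chart N W)) :
    set (chart (M * N)%type (V * W)%type) :=
  [set prod_chart c d | c in A & d in B].

Section Charts.
Context {R : realType}.

Definition chart_homeo {M : topologicalType} {V : normedModType R}
    (c : chart M V) : Prop :=
  [/\ open (dom c), open (crange c),
      forall p, dom c p -> param c (coord c p) = p,
      forall p, dom c p -> {for p, continuous (coord c)} &
      forall x, crange c x -> {for x, continuous (param c)}].

Definition smooth_atlas {M : topologicalType} {V : normedModType R}
    (A : set (chart M V)) : Prop :=
  [/\ forall c, A c -> chart_homeo c,
      forall p, exists2 c, A c & dom c p &
      forall c d, A c -> A d ->
        smooth_on (coord c @` (dom c `&` dom d)) (coord d \o param c)].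

Definition smooth_between {M N : topologicalType} {V W : normedModType R}
    (A : set (chart M V)) (B : set (chart N W)) (F : M -> N) : Prop :=
  continuous F /\
  forall c d, A c -> B d ->
    smooth_on (coord c @` (dom c `&` F @^-1` dom d)) (coord d \o F \o param c).

Lemma chart_image_open (M : topologicalType) (V : normedModType R)
    (c : chart M V) (U : set M) :
  chart_homeo c -> open U -> open (coord c @` (dom c `&` U)).
Proof.
move=> [oc orc cK _ pc] oU; rewrite openE => _ [p [cp Up] <-].
have rx : crange c (coord c p) by exists p.
have nU : nbhs (param c (coord c p)) U.
  by rewrite cK //; exact: open_nbhs_nbhs.
apply: filterS (filterI (open_nbhs_nbhs (conj orc rx)) (pc _ rx _ nU)).
by move=> _ [[q cq <-]]; rewrite /preimage /= cK // => Uq; exists q.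
Qed.

End Charts.

HB.mixin Record isManifold (R : realType) (n : nat) M of Topological M := {
  atlas : set (chart M 'rV[R]_n);
  atlasP : smooth_atlas atlas;
  manifold_hausdorff : hausdorff_space M;
  manifold_second_countable : @second_countable M }.

#[short(type="manifoldType")]
HB.structure Definition Manifold (R : realType) (n : nat) :=
  {M of Topological M & isManifold R n M}.

Arguments atlas {R n} s.

Definition smooth_map {R : realType} {m n : nat} {M : manifoldType R m}
    {N : manifoldType R n} (F : M -> N) : Prop :=
  smooth_between (atlas M) (atlas N) F.

HB.mixin Record isLieGroup (R : realType) (n : nat) G
    of Manifold R n G & Group G := {
  mul_smooth : smooth_between (prod_atlas (atlas G) (atlas G)) (atlas G)
    (fun p : G * G => (p.1 * p.2)%g);
  inv_smooth : smooth_map (fun g : G => (g^-1)%g) }.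

#[short(type="lieGroupType")]
HB.structure Definition LieGroup (R : realType) (n : nat) :=
  {G of Manifold R n G & Group G & isLieGroup R n G}.

Section SmoothFunctions.
Context {R : realType}.

Definition smooth_fun {n} {M : manifoldType R n} (f : M -> R) : Prop :=
  forall c, atlas M c -> smooth_on (crange c) (f \o param c).

Lemma chartP {n} {M : manifoldType R n} (c : chart M 'rV[R]_n) :
  atlas M c -> chart_homeo c.
Proof. by have [+ _ _] := @atlasP R n M; exact. Qed.

Lemma chart_at {n} {M : manifoldType R n} (p : M) :
  exists2 c, atlas M c & dom c p.
Proof. by have [_ + _] := @atlasP R n M; exact. Qed.

Lemma crange_open {n} {M : manifoldType R n} (c : chart M 'rV[R]_n) :
  atlas M c -> open (crange c).
Proof. by move=> /chartP[]. Qed.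

Lemma smooth_fun_comp {m n} {M : manifoldType R m} {N : manifoldType R n}
    (F : M -> N) (f : N -> R) :
  smooth_map F -> smooth_fun f -> smooth_fun (f \o F).
Proof.
move=> [cF sF] sf c Ac k; apply/Ck_pointwise => _ [p cp <-].
have [d Ad dFp] := chart_at (F p).
have [_ _ dK _ _] := chartP Ad; have [od _ _ _ _] := chartP Ad.
have [_ _ cK _ _] := chartP Ac.
have oA : open (coord c @` (dom c `&` F @^-1` dom d)).
  apply: chart_image_open; first exact: chartP.
  by apply: open_comp od => x _; exact: cF.
suff /Ck_pointwise : Ck k (coord c @` (dom c `&` F @^-1` dom d))
    (f \o F \o param c) by apply; exists p.
have := @Ck_comp _ _ k _ _ (crange d) _ _ oA _ (sf d Ad k) (sF c d Ac Ad k).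
move=> H; apply: Ck_eq (H _) => //.
  by move=> _ [q [cq dq] <-] /=; rewrite cK // dK.
by move=> _ [q [cq dq] <-]; exists (F q) => //=; rewrite cK.
Qed.

Definition smooth_funb {n} {M : manifoldType R n} : {pred M -> R} :=
  fun f => `[< smooth_fun f >].

Lemma smooth_fun_subring n (M : manifoldType R n) :
  subring_closed (@smooth_funb n M).
Proof.
split=> [|f g /asboolP sf /asboolP sg|f g /asboolP sf /asboolP sg];
  apply/asboolP => c Ac k.
- by apply: Ck_eq (Ck_cst k (crange c) (1 : R)) => //; exact: crange_open.
- have oc := crange_open Ac; apply: CkD (sf c Ac k) _ => //.
  have := CkM oc (Ck_cst k (crange c) (-1 : R)) (sg c Ac k).
  by apply: Ck_eq => // x _; rewrite /= !fctE mulN1r.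
- exact: CkM (crange_open Ac) (sf c Ac k) (sg c Ac k).
Qed.

HB.instance Definition _ n (M : manifoldType R n) :=
  GRing.isSubringClosed.Build (M -> R) (@smooth_funb n M)
    (@smooth_fun_subring n M).

Lemma smooth_fun_scale n (M : manifoldType R n) :
  GRing.scaler_closed (@smooth_funb n M : {pred (M -> R : lmodType R)}).
Proof.
move=> a f /asboolP sf; apply/asboolP => c Ac k.
exact: CkM (crange_open Ac) (Ck_cst k (crange c) a) (sf c Ac k).
Qed.

HB.instance Definition _ n (M : manifoldType R n) :=
  GRing.isScaleClosed.Build R (M -> R) (@smooth_funb n M)
    (@smooth_fun_scale n M).

Record Cinf {n : nat} (M : manifoldType R n) := MkCinf {
  Cinf_fun :> M -> R;
  _ : smooth_funb Cinf_fun }.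

Section CinfInstances.
Context {n : nat} {M : manifoldType R n}.

HB.instance Definition _ := [isSub for @Cinf_fun n M].
HB.instance Definition _ := [Choice of Cinf M by <:].
HB.instance Definition _ := 
  GRing.SubChoice_isSubComPzRing.Build _ _ (Cinf M)
    (@smooth_fun_subring n M).
HB.instance Definition _ := [SubZmodule_isSubLmodule of Cinf M by <:].

Lemma CinfP (f : Cinf M) : smooth_fun f.
Proof. exact/asboolP/(valP f). Qed.

Definition mkCinf (f : M -> R) (sf : smooth_fun f) : Cinf M :=
  MkCinf (asboolT sf).

End CinfInstances.

Definition pullback {m n} {M : manifoldType R m} {N : manifoldType R n}
    (F : M -> N) (sF : smooth_map F) (f : Cinf N) : Cinf M :=
  mkCinf (smooth_fun_comp sF (CinfP f)).

End SmoothFunctions.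

Section Tangent.
Context {R : realType}.

Definition point_derivation {n} {M : manifoldType R n} (p : M)
    (v : Cinf M -> R) : Prop :=
  scalar v /\ forall f g : Cinf M, v (f * g) = v f * g p + f p * v g.

Record tangent_space {n} {M : manifoldType R n} (p : M) := MkTangent {
  tangent_fun :> Cinf M -> R;
  tangentP : point_derivation p tangent_fun }.

Lemma tangent_map_subproof {m n} {M : manifoldType R m} {N : manifoldType R n}
    (F : M -> N) (sF : smooth_map F) (p : M) (q : N) (Fp : F p = q)
    (v : tangent_space p) :
  point_derivation q (fun f => v (pullback sF f)).
Proof.
have [lv dv] := tangentP v; split=> [a f g|f g].
  by rewrite -lv; congr (v _); exact/val_inj.
rewrite -Fp -[f (F p)]/(pullback sF f p) -[g (F p)]/(pullback sF g p) -dv.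
by congr (v _); exact/val_inj.
Qed.

(* The equation Fp lets the codomain be written T_q N rather than T_(F p) N,
   e.g. T_e G when F e = e. *)
Definition tangent_map {m n} {M : manifoldType R m} {N : manifoldType R n}
    (F : M -> N) (sF : smooth_map F) (p : M) (q : N) (Fp : F p = q)
    (v : tangent_space p) : tangent_space q :=
  MkTangent (tangent_map_subproof sF Fp v).

End Tangent.

Section LieAlgebraOfLieGroup.
Context {R : realType} {n : nat} {G : lieGroupType R n}.

Lemma smooth_mulg (g : G) : smooth_map (fun h : G => (g * h)%g).
Proof.
have [cm sm] := @mul_smooth R n G.
have cg : continuous (fun h : G => (g * h)%g).
  move=> h; apply: (@continuous_comp _ _ _ (fun h : G => (g, h))
    (fun p : G * G => (p.1 * p.2)%g)); last exact: cm.
  by apply: cvg_pair; [exact: cvg_cst|exact: cvg_id].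
split=> // c d Ac Ad k.
have [b Ab bg] := chart_at g.
have [_ _ bK _ _] := chartP Ab; have [_ _ cK _ _] := chartP Ac.
have [od _ _ _ _] := chartP Ad.
have oA : open (coord c @` (dom c `&` (fun h : G => (g * h)%g) @^-1` dom d)).
  apply: chart_image_open; first exact: chartP.
  by apply: open_comp od => x _; exact: cg.
have Abc : prod_atlas (atlas G) (atlas G) (prod_chart b c).
  by exists b => //; exists c.
pose h (x : 'rV[R]_n) := (coord b g, x).
have dh x : is_diff x h (fun v => (0, v)).
  by apply: is_diff_pair.
have := Ck_comp_affine oA dh _ (sm _ _ Abc Ad k).
have -> : (coord d \o (fun p : G * G => (p.1 * p.2)%g) \o
    param (prod_chart b c)) \o h = coord d \o (fun h => (g * h)%g) \o param c.
  by apply/funext => x /=; rewrite bK.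
by apply=> _ [q [cq dq] <-]; exists (g, q).
Qed.

(* Smooth vector fields on G are the derivations of the algebra of smooth
   functions; X is left-invariant when it commutes with left translations. *)
Definition left_invariant_field (X : Cinf G -> Cinf G) : Prop :=
  [/\ linear X,
      forall f g : Cinf G, X (f * g) = X f * g + f * X g &
      forall (a : G) (f : Cinf G),
        X (pullback (smooth_mulg a) f) = pullback (smooth_mulg a) (X f)].

Definition left_invariant_fieldb : {pred Cinf G -> Cinf G} :=
  fun X => `[< left_invariant_field X >].

Lemma left_invariant_field_submod :
  GRing.submod_closed
    (left_invariant_fieldb : {pred (Cinf G -> Cinf G : lmodType R)}).
Proof.
split=> [|a X Y /asboolP[lX dX iX] /asboolP[lY dY iY]]; apply/asboolP; split.
- by move=> a f g; change ((0 : Cinf G) = a *: 0 + 0); rewrite scaler0 addr0.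
- move=> f g; change ((0 : Cinf G) = 0 * g + f * 0).
  by rewrite mul0r mulr0 addr0.
- by move=> a f; exact/val_inj.
- move=> b f g; change (a *: X (b *: f + g) + Y (b *: f + g) =
    b *: (a *: X f + Y f) + (a *: X g + Y g)); rewrite lX lY !scalerDr !scalerA (mulrC a b).
  by rewrite -!addrA; congr (_ + _); rewrite addrCA.
- move=> f g; change (a *: X (f * g) + Y (f * g) =
    (a *: X f + Y f) * g + f * (a *: X g + Y g)); rewrite dX dY; apply/val_inj/funext => x.
  change (a * (X f x * g x + f x * X g x) + (Y f x * g x + f x * Y g x) =
    (a * X f x + Y f x) * g x + f x * (a * X g x + Y g x)); ring.
- move=> b f; change (a *: X (pullback (smooth_mulg b) f) +
    Y (pullback (smooth_mulg b) f) =
    pullback (smooth_mulg b) (a *: X f + Y f)); rewrite iX iY.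
  exact/val_inj.
Qed.

HB.instance Definition _ :=
  GRing.isSubmodClosed.Build R (Cinf G -> Cinf G) left_invariant_fieldb
    left_invariant_field_submod.

End LieAlgebraOfLieGroup.

Record lie_algebra {R : realType} {n : nat} (G : lieGroupType R n) :=
  MkLie {
    lie_field :> Cinf G -> Cinf G;
    _ : left_invariant_fieldb lie_field }.

Section LieAlgebraInstances.
Context {R : realType} {n : nat} {G : lieGroupType R n}.

HB.instance Definition _ := [isSub for @lie_field R n G].
HB.instance Definition _ := [Choice of lie_algebra G by <:].
HB.instance Definition _ := [SubChoice_isSubLmodule of lie_algebra G by <:].

Lemma lie_fieldP (X : lie_algebra G) : left_invariant_field X.
Proof. exact/asboolP/(valP X). Qed.

Lemma lie_bracket_subproof (X Y : lie_algebra G) :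
  left_invariant_fieldb (fun f => X (Y f) - Y (X f)).
Proof.
have [lX dX iX] := lie_fieldP X; have [lY dY iY] := lie_fieldP Y.
apply/asboolP; split.
- move=> a f g; rewrite lY lX lX lY scalerBr opprD !addrA.
  by congr (_ - _); rewrite addrAC.
- move=> f g; rewrite dY dX.
  have XD u v : X (u + v) = X u + X v by have := lX 1 u v; rewrite !scale1r.
  have YD u v : Y (u + v) = Y u + Y v by have := lY 1 u v; rewrite !scale1r.
  rewrite XD YD !dX !dY; apply/val_inj/funext => x.
  change (X (Y f) x * g x + Y f x * X g x + (X f x * Y g x + f x * X (Y g) x) -
      (Y (X f) x * g x + X f x * Y g x + (Y f x * X g x + f x * Y (X g) x)) =
    (X (Y f) x - Y (X f) x) * g x + f x * (X (Y g) x - Y (X g) x)); ring.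
- by move=> a f; rewrite iY iX iX iY; exact/val_inj.
Qed.

Definition lie_bracket (X Y : lie_algebra G) : lie_algebra G :=
  MkLie (lie_bracket_subproof X Y).

Lemma lie_at_subproof (g : G) (X : lie_algebra G) :
  point_derivation g (fun f => X f g).
Proof.
by have [lX dX _] := lie_fieldP X; split=> [a f h|f h]; rewrite ?lX ?dX.
Qed.

Definition lie_at (g : G) (X : lie_algebra G) : tangent_space g :=
  MkTangent (lie_at_subproof g X).

(* A left-invariant field is determined by its value at e, which identifies
   lie_algebra G with T_e G. *)
Lemma lie_at1_inj : injective (lie_at (1%g : G)).
Proof.
move=> X Y XY; apply/val_inj/funext => f; apply/val_inj/funext => a.
have [_ _ iX] := lie_fieldP X; have [_ _ iY] := lie_fieldP Y.
have XYf (h : Cinf G) : X h 1%g = Y h 1%g.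
  by have := congr1 (fun v : tangent_space (1%g : G) => v h) XY.
have := XYf (pullback (smooth_mulg a) f).
by rewrite iX iY /= mulg1.
Qed.

End LieAlgebraInstances.

Section Operators.
Context {R : realType} {n : nat} {G : lieGroupType R n}.

Definition Ad (g h : G) : G := (g * h * g^-1)%g.

Definition rota_baxter_operator (eps : R) (B : G -> G) : Prop :=
  smooth_map B /\
  ((eps = 1 /\ forall g1 g2, (B g1 * B g2)%g = B (g1 * Ad (B g1) g2)%g) \/
   (eps = -1 /\ forall g1 g2, (B g1 * B g2)%g = B (Ad (B g1) g2 * g1)%g)).

Definition differential_operator (eps : R) (D : G -> G) : Prop :=
  smooth_map D /\
  ((eps = 1 /\ forall g h, D (g * h)%g = (D g * Ad g (D h))%g) \/
   (eps = -1 /\ forall g h, D (g * h)%g = (Ad g (D h) * D g)%g)).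

Lemma differential_operator_smooth eps D :
  differential_operator eps D -> smooth_map D.
Proof. by case. Qed.

Lemma differential_operator1 eps D :
  differential_operator eps D -> D 1%g = 1%g.
Proof.
by case=> _ [[_ dD]|[_ dD]]; have /esym := dD 1%g 1%g;
  rewrite /Ad invg1 !mul1g !mulg1 => /(canRL (mulKg _)); rewrite mulVg.
Qed.

(* D_{*e} : T_e G -> T_e G. *)
Definition tangent_at1 eps D (hD : differential_operator eps D) :
    tangent_space (1%g : G) -> tangent_space (1%g : G) :=
  tangent_map (differential_operator_smooth hD) (differential_operator1 hD).

End Operators.

Definition is_lie_bracket {K : fieldType} {L : lmodType K}
    (br : L -> L -> L) : Prop :=
  [/\ forall z, linear (br^~ z), forall z, linear (br z),
      forall x, br x x = 0 &
      forall x y z, br x (br y z) + br y (br z x) + br z (br x y) = 0].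

Definition differential_lie_algebra {K : fieldType} {L : lmodType K}
    (lambda : K) (br : L -> L -> L) (D : L -> L) : Prop :=
  [/\ is_lie_bracket br, linear D &
      forall u v, D (br u v) =
        br (D u) v + br u (D v) + lambda *: br (D u) (D v)].

(* Main.v *)
Require Import Defs.
From HB Require Import structures.
From mathcomp Require Import all_boot all_order all_algebra.
From mathcomp Require Import all_classical all_reals all_analysis.
From mathcomp Require Import ring.

(** Part (1) is obtained by applying the Rota-Baxter identity of the inverse
    operator to [D g] and [D h].

    For part (2) and weight [1], the identity [D (g h) = D g * Ad_g (D h)] says
    exactly that [P g = D g * g] is a group morphism. The differential of the
    multiplication of [G] at [(1, 1)] is the addition, so the tangent map of [P]
    at [1] is [D_* + id]. As the tangent map of a smooth group morphism, it
    preserves the Lie bracket, and the expansion of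
    [(D_* + id) [u, v] = [(D_* + id) u, (D_* + id) v]] is the Leibniz rule of
    weight [1]. Weight [-1] reduces to weight [1]: if [D] has weight [-1], then
    [g |-> (D g)^-1] has weight [1] and its tangent map is [- D_*], while a
    change of sign exchanges the Leibniz rules of weights [1] and [-1].

    The Lie algebra consists of left-invariant derivations of the algebra of
    smooth functions and tangent vectors are point derivations of this algebra,
    so two facts link them to the computation above. First, a point derivation
    is a directional derivative in any chart ([point_derivation_chart]); this
    rests on smooth bump functions ([bump]), on their extension by zero to the
    manifold ([zero_extension_smooth]) and on Hadamard's lemma ([hadamard]).
    From it follow the product rule for tangent maps ([derivation_mul]) and the
    existence of a left-invariant field with a prescribed value at [1]
    ([left_invariant_extension]), which makes the tangent map at [1] of any
    smooth map fixing [1] act on the Lie algebra ([lie_push]). Second, a field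
    is related by a group morphism to its image ([lie_push_hom]), from which the
    compatibility with brackets is formal. *)

Set Implicit Arguments.
Unset Strict Implicit.
Unset Printing Implicit Defensive.

Import Order.TTheory GRing.Theory Num.Theory.
Import numFieldNormedType.Exports.
(* [coord] is the map of a chart, not the coordinates in a basis. *)
Import Defs.

Local Open Scope ring_scope.

(** * Calculus of iterated differentiability *)

Section MoreCk.
Local Open Scope classical_set_scope.
Context {R : realType}.
Implicit Types V W : normedModType R.

Lemma Ck_id V k (A : set V) : Ck k A (@id V).
Proof.
case: k => [|k]; first by move=> x _; exact: cvg_id.
split=> [x _|v]; first by have [] := is_diff_id x.
rewrite (_ : 'D_v id = cst v); first exact: Ck_cst.
apply/funext => x; rewrite deriveE; last by have [] := is_diff_id x.
by rewrite diff_val.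
Qed.

Lemma Ck_scaler V W k (A : set V) (f : V -> R) (w : W) : open A ->
  Ck k A f -> Ck k A (fun x => f x *: w).
Proof.
move=> oA; elim: k f => [|k IH] f.
  by move=> cf x Ax;
    exact: continuous_comp (cf x Ax) (@scalel_continuous _ _ w _).
move=> [df Df]; split=> [x Ax|v]; first exact/differentiableZl/df.
apply: Ck_eq (IH _ (Df v)) => // x Ax.
by rewrite !deriveE ?diffZl //; [exact: df|exact/differentiableZl/df|exact: df].
Qed.

Lemma Ck_row V k n (A : set V) (f : V -> 'rV[R]_n) : open A ->
  (forall j, Ck k A (fun x => f x ord0 j)) -> Ck k A f.
Proof.
move=> oA cf.
suff : Ck k A (\sum_j fun x => f x ord0 j *: (delta_mx ord0 j : 'rV[R]_n)).
  by apply: Ck_eq => // x _; rewrite fct_sumE -row_sum_delta.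
apply: big_ind => [|g h|j _]; first exact: (@Ck_cst _ _ _ k A 0).
  exact: CkD.
exact: Ck_scaler.
Qed.

(** The domain of [f] is a product of two row spaces and not a row space, so the
    chain rule for ['rV[R]_n] does not apply; the partial derivatives of [f] in
    the two blocks of coordinates take its place. *)
Lemma Ck_comp2 V k m n (A : set V) (B : set ('rV[R]_m * 'rV[R]_n))
    (h1 : V -> 'rV[R]_m) (h2 : V -> 'rV[R]_n) (f : 'rV[R]_m * 'rV[R]_n -> R) :
  open A -> (forall x, A x -> B (h1 x, h2 x)) ->
  Ck k B f -> Ck k A h1 -> Ck k A h2 -> Ck k A (fun x => f (h1 x, h2 x)).
Proof.
move=> oA AB; elim: k f => [|k IH] f.
  move=> cf c1 c2 x Ax.
  apply: (@continuous_comp _ _ _ (fun x => (h1 x, h2 x)) f); last exact/cf/AB.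
  exact: cvg_pair (c1 x Ax) (c2 x Ax).
move=> cf c1 c2; have [df Df] := cf; have [d1 D1] := c1; have [d2 D2] := c2.
have dh x : A x -> differentiable (fun x => (h1 x, h2 x)) x.
  by move=> Ax; apply: differentiable_pair; [exact: d1|exact: d2].
split=> [x Ax|v].
  by apply: (@differentiable_comp _ _ _ _ (fun x => (h1 x, h2 x)) f);
    [exact: dh|exact/df/AB].
have : Ck k A (\sum_j ((fun x => ('D_v h1 x) ord0 j) *
                 (fun x => 'D_(delta_mx ord0 j, 0) f (h1 x, h2 x))) +
               \sum_j ((fun x => ('D_v h2 x) ord0 j) *
                 (fun x => 'D_(0, delta_mx ord0 j) f (h1 x, h2 x)))).
  apply: CkD => //; apply: Ck_sum => // j; apply: CkM => //.
  - exact: (Ck_coord j oA (D1 v)).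
  - exact: IH (Df _) (CkW c1) (CkW c2).
  - exact: (Ck_coord j oA (D2 v)).
  - exact: IH (Df _) (CkW c1) (CkW c2).
apply: Ck_eq => // x Ax.
have dfh : differentiable f (h1 x, h2 x) by exact/df/AB.
have dhx := dh x Ax; have d1x := d1 x Ax; have d2x := d2 x Ax.
rewrite [RHS]deriveE; last exact: (@differentiable_comp _ _ _ _ _ f).
rewrite (@diff_comp _ _ _ _ (fun x => (h1 x, h2 x)) f) //=.
rewrite (diff_pair d1x d2x) -(deriveE v d1x) -(deriveE v d2x).
have -> : ('D_v h1 x, 'D_v h2 x) =
    ('D_v h1 x, 0 : 'rV[R]_n) + (0 : 'rV[R]_m, 'D_v h2 x).
  by rewrite -[RHS]/('D_v h1 x + 0, 0 + 'D_v h2 x) addr0 add0r.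
rewrite linearD /= !fctE !fct_sumE; congr (_ + _).
  rewrite [in RHS](row_sum_delta ('D_v h1 x)).
  have -> : (\sum_j 'D_v h1 x ord0 j *: delta_mx ord0 j, 0) =
    \sum_j 'D_v h1 x ord0 j *: (delta_mx ord0 j, 0) :> 'rV[R]_m * 'rV[R]_n.
    elim/big_rec2 : _ => // j p q _ <-.
    by congr pair; rewrite /= scaler0 add0r.
  by rewrite linear_sum; apply: eq_bigr => j _; rewrite linearZ /= -deriveE.
rewrite [in RHS](row_sum_delta ('D_v h2 x)).
have -> : (0, \sum_j 'D_v h2 x ord0 j *: delta_mx ord0 j) =
  \sum_j 'D_v h2 x ord0 j *: (0, delta_mx ord0 j) :> 'rV[R]_m * 'rV[R]_n.
  elim/big_rec2 : _ => // j p q _ <-.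
  by congr pair; rewrite /= scaler0 add0r.
by rewrite linear_sum; apply: eq_bigr => j _; rewrite linearZ /= -deriveE.
Qed.

Lemma Ck_comp_real V k (A : set V) (h : V -> R) (f : R -> R) : open A ->
  Ck k setT f -> Ck k A h -> Ck k A (f \o h).
Proof.
move=> oA cf ch.
pose p (u : 'rV[R]_1) := u ord0 ord0.
have pl : linear p by move=> a u w; rewrite /p !mxE.
pose pL : {linear 'rV[R]_1 -> R} :=
  HB.pack p (GRing.isLinear.Build _ _ _ _ p pl).
have pc : continuous pL by exact: coord_continuous.
have pd u : is_diff u p p.
  apply: DiffDef; first exact: (@linear_differentiable _ _ _ pL).
  exact: (@diff_lin _ _ _ pL).
have := @Ck_comp _ _ k _ A setT (fun x => const_mx (h x)) (f \o p) oA.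
have -> : (f \o p) \o (fun x => const_mx (h x)) = f \o h.
  by apply/funext => x /=; rewrite /p mxE.
apply=> //; first by apply: Ck_comp_affine pd _ cf => //; exact: openT.
by apply: Ck_row => // j; apply: Ck_eq ch => // x _; rewrite mxE.
Qed.

Lemma Ck_comp_row (V : normedModType R) k m n (A : set V) (B : set 'rV[R]_m)
    (h : V -> 'rV[R]_m) (f : 'rV[R]_m -> 'rV[R]_n) :
  open A -> open B -> (forall x, A x -> B (h x)) ->
  Ck k B f -> Ck k A h -> Ck k A (f \o h).
Proof.
move=> oA oB AB cf ch; apply: (Ck_row oA) => j.
exact: (Ck_comp oA AB (Ck_coord j oB cf) ch).
Qed.

Lemma Ck_comp2_row (V : normedModType R) k m n p (A : set V)
    (B : set ('rV[R]_m * 'rV[R]_n)) (h1 : V -> 'rV[R]_m) (h2 : V -> 'rV[R]_n)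
    (f : 'rV[R]_m * 'rV[R]_n -> 'rV[R]_p) :
  open A -> open B -> (forall x, A x -> B (h1 x, h2 x)) ->
  Ck k B f -> Ck k A h1 -> Ck k A h2 -> Ck k A (fun x => f (h1 x, h2 x)).
Proof.
move=> oA oB AB cf c1 c2; apply: (Ck_row oA) => j.
exact: (Ck_comp2 oA AB (Ck_coord j oB cf) c1 c2).
Qed.

(** The differential of [f] is linear, so it sees a simultaneous motion of its
    two arguments as the sum of the two separate motions. *)
Lemma derive_pair_split m n (V : normedModType R) (h1 : V -> 'rV[R]_m)
    (h2 : V -> 'rV[R]_n) (f : 'rV[R]_m * 'rV[R]_n -> R) (x w : V) :
  differentiable h1 x -> differentiable h2 x ->
  differentiable f (h1 x, h2 x) ->
  'D_w (fun y => f (h1 y, h2 y)) x =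
  'D_w (fun y => f (h1 y, h2 x)) x + 'D_w (fun y => f (h1 x, h2 y)) x.
Proof.
have chain (k1 : V -> 'rV[R]_m) (k2 : V -> 'rV[R]_n) :
    differentiable k1 x -> differentiable k2 x ->
    differentiable f (k1 x, k2 x) ->
    'D_w (fun y => f (k1 y, k2 y)) x = 'd f (k1 x, k2 x) ('D_w k1 x, 'D_w k2 x).
  move=> d1 d2 df; pose k y := (k1 y, k2 y).
  have dk : differentiable k x by exact: differentiable_pair.
  have dfk : differentiable (f \o k) x by exact: differentiable_comp.
  rewrite [LHS](deriveE w dfk) diff_comp//= /k (diff_pair d1 d2).
  by rewrite -(deriveE w d1) -(deriveE w d2).
move=> d1 d2 df.
rewrite chain// (chain h1 (cst (h2 x)))// (chain (cst (h1 x)) h2)//.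
rewrite !derive_cst -linearD; congr ('d f _ _).
by rewrite -[RHS]/('D_w h1 x + 0, 0 + 'D_w h2 x) addr0 add0r.
Qed.

(** The derivative in the second variable is a directional derivative of [f]
    itself, so it inherits the joint smoothness of [f]. *)
Lemma derive_slice (U V W : normedModType R) (f : U * V -> W)
    (x : U) (y w : V) : 'D_(0, w) f (x, y) = 'D_w (fun y => f (x, y)) y.
Proof.
rewrite /derive; set F := fun h : R => _; set F' := fun h : R => _.
suff -> : F = F' by [].
by apply/funext => h; rewrite /F /F'; congr (_ *: (f _ - _));
  rewrite -[LHS]/(h *: 0 + x, h *: w + y) scaler0 add0r.
Qed.

Lemma differentiable_remainder (V W : normedModType R)
    (f : V -> W) (L : {linear V -> W}) (x : V) : continuous L ->
  (forall e : R, 0 < e ->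
    \forall h \near (0 : V), `|f (h + x) - f x - L h| <= e * `|h|) ->
  differentiable f x /\ 'd f x = L :> (V -> W).
Proof.
move=> Lc fL; suff E : f \o shift x = cst (f x) + L +o_ 0 id.
  have dE := diff_unique Lc E.
  by split=> //; apply/diff_locallyP; rewrite dE.
apply/eqaddoP => _ /posnumP[e]; near=> h.
rewrite -[X in `|X|]/(f (h + x) - (f x + L h)) opprD addrA.
by near: h; exact: fL.
Unshelve. all: by end_near. Qed.

Lemma Ck_continuous V W k (A : set V) (f : V -> W) : Ck k A f ->
  forall x, A x -> {for x, continuous f}.
Proof. by elim: k => [//|k IH] /CkW. Qed.

Lemma derive_linear V W (f : V -> W) y :
  differentiable f y -> linear (fun h => 'D_h f y).
Proof. by move=> df a u v; rewrite !deriveE// linearP. Qed.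

Lemma derive_coord n (f : 'rV[R]_n -> R) h y : differentiable f y ->
  'D_h f y = \sum_j h ord0 j * 'D_(delta_mx ord0 j) f y.
Proof.
move=> dfy; rewrite deriveE// {1}(row_sum_delta h) linear_sum.
by apply: eq_bigr => j _; rewrite linearZ -deriveE.
Qed.

Lemma is_derive_line V W (f : V -> W) (p h : V) (s : R) :
  differentiable f (p + s *: h) ->
  is_derive s 1 (fun s => f (p + s *: h)) ('D_h f (p + s *: h)).
Proof.
pose g (s : R) : V := p + s *: h.
rewrite -/(g s) -[X in is_derive _ _ X]/(f \o g) => df.
have dg : is_diff s g (fun s => s *: h).
  have := is_diffD (is_diff_cst p s) (is_diff_scalel s h).
  by rewrite add0r.
have dgs : differentiable g s by [].
have dfg := differentiable_comp dgs df.
apply: DeriveDef; first exact/derivable1_diffP.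
rewrite deriveE// diff_comp//= diff_val.
by rewrite scale1r -deriveE.
Qed.

Lemma mean_value_line V (f : V -> R) (p h : V) :
  (forall c : R, c \in `[0, 1]%R -> differentiable f (p + c *: h)) ->
  exists2 c : R, c \in `[0, 1]%R & f (p + h) - f p = 'D_h f (p + c *: h).
Proof.
move=> df; pose F (c : R) := f (p + c *: h).
pose dF (c : R) := 'D_h f (p + c *: h).
have FdF (c : R) : c \in `[0, 1]%R -> is_derive c 1 F (dF c).
  by move=> c01; apply: is_derive_line; exact: df.
have FdF' (c : R) : c \in `]0, 1[%R -> is_derive c 1 F (dF c).
  by move=> c01; apply: FdF; exact: subset_itv_oo_cc.
have cF : {within `[0, 1], continuous F}.
  apply: continuous_in_subspaceT => c /[1!inE] c01.
  by have [/derivable1_diffP/differentiable_continuous] := FdF _ c01.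
have [c c01 Fc] := @MVT_segment R F dF 0 1 ler01 FdF' cF.
exists c => //; move: Fc; rewrite subr0 mulr1 /F scale1r scale0r addr0.
exact.
Qed.

End MoreCk.

(** * Smooth bump functions *)

Section Bump.
Local Open Scope classical_set_scope.
Context {R : realType}.

(** The functions [x^-m * exp (- 1 / x)], extended by [0]: the family is closed
    under differentiation up to linear combination, so a single induction shows
    that all its members, in particular [exp (- 1 / x)], are smooth. *)
Definition flat (m : nat) (x : R) : R :=
  if 0 < x then x^-1 ^+ m * expR (- x^-1) else 0.

(** Since [exp y >= y ^ (m+2) / (m+2)!], every [flat m] vanishes to second order
    at [0], which is what makes it differentiable there. *)
Lemma flat_bound m (x : R) : `|flat m x| <= m.+2`!%:R * x ^+ 2.
Proof.
rewrite /flat; case: ifP => x0; last first.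
  by rewrite normr0 mulr_ge0 ?ler0n// sqr_ge0.
have y0 : 0 < x^-1 by rewrite invr_gt0.
have := expR_ge1Dxn m.+1 (ltW y0).
rewrite ger0_norm ?mulr_ge0 ?expR_ge0 ?exprn_ge0 ?(ltW y0)// => H.
have F0 : (0 : R) < m.+2`!%:R by rewrite ltr0n fact_gt0.
have {H}H : x^-1 ^+ m.+2 <= m.+2`!%:R * expR x^-1.
  rewrite mulrC -ler_pdivrMr //; apply: le_trans H.
  by rewrite lerDr ler01.
rewrite expRN ler_pdivrMr ?expR_gt0// mulrAC.
rewrite -ler_pdivrMr ?exprn_gt0// -exprVn -exprD addn2; exact: H.
Qed.

Lemma is_derive_flat_pos m (x : R) : 0 < x ->
  is_derive x 1 (fun y : R => y^-1 ^+ m * expR (- y^-1))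
    (flat m.+2 x - m%:R * flat m.+1 x).
Proof.
move=> x0; have xn0 : x != 0 by rewrite gt_eqF.
have dI : is_derive x 1 (fun y : R => y^-1) (- x ^- 2).
  have := @is_deriveV _ id x 1 1 xn0 (is_derive_id x (1 : R)).
  by rewrite /GRing.scale /= mulr1.
have dE := is_derive1_comp (is_derive_expR _) (is_deriveN dI).
have := is_deriveM (is_deriveX m dI) dE.
rewrite (_ : ((fun y : R => y^-1) ^+ m * (expR \o - (fun y : R => y^-1))) =
  (fun y : R => y^-1 ^+ m * expR (- y^-1))); last first.
  by apply/funext => y; rewrite /= !fctE.
move=> D0; apply: (is_derive_eq D0); rewrite /flat x0 /= !fctE /GRing.scale /=.
case: m {D0} => [|m]; rewrite /= ?exprS ?expr0; field => //.
Qed.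

Lemma is_derive_flat m (x : R) :
  is_derive x 1 (flat m) (flat m.+2 x - m%:R * flat m.+1 x).
Proof.
have flat0 k (y : R) : y <= 0 -> flat k y = 0.
  by rewrite /flat leNgt => /negbTE->.
have [x0|x0|->] := ltgtP x 0.
- have fg : \near x, cst 0 x = flat m x.
    by near=> y; rewrite flat0// ltW//; near: y; exact: lt_nbhsl.
  rewrite !flat0 ?ltW// mulr0 subr0.
  exact: near_eq_is_derive fg (is_derive_cst (0 : R) x (1 : R)).
- have fg : \near x, x^-1 ^+ m * expR (- x^-1) = flat m x.
    by near=> y; rewrite /flat ifT//; near: y; exact: lt_nbhsr.
  exact: near_eq_is_derive fg (is_derive_flat_pos m x0).
have H : h^-1 *: (flat m (h *: 1 + 0) - flat m 0) @[h --> 0^'] --> (0 : R).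
  apply/cvgr0Pnorm_lt => e e0.
  have F0 : (0 : R) < m.+2`!%:R by rewrite ltr0n fact_gt0.
  near=> h; rewrite (flat0 m 0)// subr0 normrM normfV.
  have h0 : h != 0 by near: h; exact: nbhs_dnbhs_neq.
  rewrite mulrC ltr_pdivrMr ?normr_gt0//.
  rewrite (_ : h *: 1 + 0 = h); last by rewrite addr0 /GRing.scale /= mulr1.
  apply: le_lt_trans (flat_bound m h) _.
  rewrite -real_normK ?num_real// expr2 mulrA ltr_pM2r ?normr_gt0//.
  rewrite mulrC -ltr_pdivlMr//; near: h.
  by apply: dnbhs0_lt; rewrite divr_gt0.
rewrite !flat0// mulr0 subr0; split; first by apply/cvg_ex; exists 0; exact: H.
exact: cvg_lim H.
Unshelve. all: by end_near. Qed.

Lemma Ck_flat m k (A : set R) : Ck k A (flat m).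
Proof.
apply: (@Ck_sub _ _ _ k A setT) => //; elim: k m => [|k IH] m.
  move=> x _; apply/differentiable_continuous/derivable1_diffP.
  by have [] := is_derive_flat m x.
split=> [x _|v].
  by apply/derivable1_diffP; have [] := is_derive_flat m x.
have -> : 'D_v (flat m) =
    (fun x => flat m.+2 x *: v) + (fun x => flat m.+1 x *: (- m%:R * v)).
  apply/funext => x; have d1 := is_derive_flat m x.
  have [/derivable1_diffP dx _] := d1.
  rewrite !fctE (deriveE _ dx) (diff1E dx) derive1E.
  rewrite (@derive_val _ _ _ _ _ _ _ d1) /GRing.scale /=; ring.
by apply: CkD; [exact: openT|apply: Ck_scaler => //; exact: openT..].
Qed.

(** The support is enclosed in a cube rather than in a ball because cubes of
    ['rV[R]_n] are compact whatever [n] is, [n = 0] included. *)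
Lemma bump n (x0 : 'rV[R]_n) (r : R) : 0 < r ->
  exists b : 'rV[R]_n -> R, [/\ smooth_on setT b, b x0 = 1 &
    forall x, b x != 0 -> forall j, `|x ord0 j - x0 ord0 j| <= r].
Proof.
move=> r0.
pose q (x : 'rV[R]_n) := r ^+ 2 - \sum_j (x ord0 j - x0 ord0 j) ^+ 2.
have sq : smooth_on setT q.
  move=> k; have oT : open (setT : set 'rV[R]_n) by exact: openT.
  have cx j : Ck k setT (fun x : 'rV[R]_n => x ord0 j - x0 ord0 j).
    exact: (CkD oT (Ck_coord j oT (@Ck_id _ _ k setT)) (Ck_cst k _ _)).
  have -> : q = cst (r ^+ 2) + cst (-1) * \sum_j
      ((fun x : 'rV[R]_n => x ord0 j - x0 ord0 j) *
       (fun x : 'rV[R]_n => x ord0 j - x0 ord0 j)).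
    by apply/funext => x; rewrite /q !fctE fct_sumE mulN1r.
  apply: CkD => //; first exact: Ck_cst.
  apply: CkM => //; first exact: Ck_cst.
  by apply: Ck_sum => // j; exact: CkM.
have qx0 : q x0 = r ^+ 2.
  by rewrite /q big1 ?subr0// => j _; rewrite subrr expr0n.
have f0 : flat 0 (r ^+ 2) != 0.
  by rewrite /flat exprn_gt0// expr0 mul1r expR_eq0.
exists (fun x => (flat 0 (r ^+ 2))^-1 * flat 0 (q x)); split.
- move=> k; apply: (@CkM _ _ k setT (cst _)); [exact: openT|exact: Ck_cst|].
  by apply: Ck_comp_real; [exact: openT|exact: Ck_flat|exact: sq].
- by rewrite qx0 mulVf.
move=> x + j; rewrite mulf_eq0 negb_or /flat => /andP[_].
case: ifP => [qx _|_]; last by rewrite eqxx.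
rewrite -ler_sqr ?nnegrE ?(ltW r0)// real_normK ?num_real//.
move: qx; rewrite /q subr_gt0 => /ltW; apply: le_trans.
by rewrite (bigD1 j)//= lerDl sumr_ge0// => i _; exact: sqr_ge0.
Qed.

End Bump.

(** * Hadamard's lemma *)

Section Hadamard.
Local Open Scope classical_set_scope.
Context {R : realType} {n : nat}.
Local Notation V := 'rV[R]_n.
Local Notation mu := (@lebesgue_measure R).
Implicit Types (f : V -> R) (x : V) (r t : R).

Definition seg (x0 : V) x t : V := x0 + t *: (x - x0).

Lemma seg_ball (x0 : V) x r t :
  ball x0 r x -> t \in `[0, 1]%R -> ball x0 r (seg x0 x t).
Proof.
rewrite -ball_normE in_itv /= => xr /andP[t0 t1].
rewrite opprD addrA subrr sub0r normrN normrZ ger0_norm// distrC.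
by apply: le_lt_trans xr; rewrite ler_piMl.
Qed.

Lemma seg_cvg (x0 : V) x t :
  seg x0 p.2 p.1 @[p --> (t, x)] --> seg x0 x t.
Proof.
apply: cvgD; first exact: cvg_cst.
apply: cvgZ; first exact: cvg_fst.
by apply: cvgB; [exact: cvg_snd|exact: cvg_cst].
Qed.

(** The mean of [f] along the segment from [x0] to [x], weighted by [t ^ m]; the
    weight is there because differentiation under the integral raises [m]. *)
Definition radial_mean (x0 : V) m f x : R :=
  \int[mu]_(t in `[0, 1]) (t ^+ m * f (seg x0 x t)).

Section OnBall.
Variables (x0 : V) (r : R).
Local Notation B := (ball x0 r).

(** Continuity of [f] is uniform along the compact segment; this is the only
    uniformity that the passage to the limit under the integral requires. *)
Lemma seg_uniform f x (e : R) : (forall x, B x -> {for x, continuous f}) ->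
  B x -> 0 < e ->
  \forall y \near x, forall t, t \in `[0, 1]%R ->
    `|f (seg x0 y t) - f (seg x0 x t)| < e.
Proof.
move=> cf Bx e0.
have := @segment_compact R 0 1.
move=> /compact_near_coveringP/(_ V (nbhs x)
  (fun y t => `|f (seg x0 y t) - f (seg x0 x t)| < e)).
apply=> t0 t01.
have e2 : 0 < e / 2 by rewrite divr_gt0.
have ct := cf _ (seg_ball Bx t01).
have fc : f (seg x0 p.2 p.1) @[p --> (t0, x)] --> f (seg x0 x t0).
  by apply: continuous_cvg; [exact: ct|exact: seg_cvg].
move/cvgrPdist_lt/(_ _ e2): fc => [[/= P Q] [Pt Qx] PQ].
exists (P, Q) => //= -[t y] [/= Pt' Qy].
have H1 := PQ (t, y) (conj Pt' Qy).
have H2 := PQ (t, x) (conj Pt' (nbhs_singleton Qx)).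
rewrite /= in H1 H2.
rewrite (splitr e) -(subrKA (f (seg x0 x t0))).
by apply: le_lt_trans (ler_normD _ _) _; rewrite ltrD// distrC.
Qed.

Lemma radial_integrable m f x : (forall x, B x -> {for x, continuous f}) ->
  B x -> mu.-integrable `[0, 1] (EFin \o (fun t => t ^+ m * f (seg x0 x t))).
Proof.
move=> cf Bx; apply: continuous_compact_integrable.
  exact: segment_compact.
apply: continuous_in_subspaceT => t /[1!inE] t01.
suff : {for t, continuous (fun t => f (seg x0 x t))}.
  by move=> ct; exact: cvgM (@exprn_continuous R m t) ct.
apply: (@continuous_comp _ _ _ (seg x0 x) f); last exact/cf/seg_ball.
apply: cvgD; first exact: cvg_cst.
by apply: cvgZr_tmp; exact: cvg_id.
Qed.

Lemma Rintegral01_le (g : R -> R) (e : R) :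
  mu.-integrable `[0, 1] (EFin \o g) ->
  (forall t, t \in `[0, 1]%R -> `|g t| <= e) ->
  `|\int[mu]_(t in `[0, 1]) g t| <= e.
Proof.
move=> ig ge; apply: le_trans (le_normr_Rintegral _ ig) _ => //.
have -> : e = \int[mu]_(t in `[0, 1]) e.
  by rewrite Rintegral_cst//= lebesgue_measure_itv/= lte01 oppr0 adde0 mulr1.
apply: le_Rintegral => //.
- exact: integrable_norm.
- exact: continuous_compact_integrable (@segment_compact _ _ _)
    (continuous_subspaceT (fun=> cvg_cst _)).
Qed.


Lemma radial_mean_continuous f m x : (forall x, B x -> {for x, continuous f}) ->
  B x -> {for x, continuous (radial_mean x0 m f)}.
Proof.
move=> cf Bx; apply/(@cvgrPdist_lt _ _ _ _ (nbhs_filter x)) => e e0.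
have e2 : 0 < e / 2 by rewrite divr_gt0.
have nB : \near x, B x.
  by apply: open_nbhs_nbhs; split=> //; exact: ball_open.
near=> y.
have By : B y by near: y.
rewrite -RintegralB//; [|exact: radial_integrable..].
apply: (@le_lt_trans _ _ (e / 2)); last by rewrite gtr_pMr// invf_lt1 ?ltr1n.
apply: Rintegral01_le => [|t t01].
  have := integrableB _ (radial_integrable m cf Bx) (radial_integrable m cf By).
  by move=> /(_ (measurable_itv _)); apply: eq_integrable.
rewrite -mulrBr normrM -[leRHS]mul1r distrC.
have [t0 t1] : 0 <= t /\ t <= 1.
  by move: t01; rewrite in_itv/= => /andP[].
apply: ler_pM; [exact: normr_ge0|exact: normr_ge0| |].
  by rewrite ger0_norm ?exprn_ge0// exprn_ile1.
apply/ltW; move: {t0 t1} t t01; near: y; exact: seg_uniform.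
Unshelve. all: by end_near. Qed.

Section C1.
Variable f : V -> R.
Hypothesis df : forall x, B x -> differentiable f x.
Hypothesis Df : forall v x, B x -> {for x, continuous ('D_v f)}.

Lemma radial_mean_linear m x : B x ->
  linear (fun h => radial_mean x0 m ('D_h f) x).
Proof.
move=> Bx a u v; rewrite /radial_mean.
have iu := radial_integrable m (@Df u) Bx.
have iv := radial_integrable m (@Df v) Bx.
rewrite /GRing.scale /= -RintegralZl// -RintegralD//; last first.
  have := integrableZl _ a iu; move=> /(_ (measurable_itv _)).
  by apply: eq_integrable.
apply: eq_Rintegral => t /[1!inE] t01.
rewrite derive_linear; first by rewrite /GRing.scale /=; ring.
exact/df/seg_ball.
Qed.

Lemma radial_mean_coord m x h : B x -> radial_mean x0 m ('D_h f) x =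
  \sum_j h ord0 j * radial_mean x0 m ('D_(delta_mx ord0 j) f) x.
Proof.
move=> Bx; pose L := fun h => radial_mean x0 m ('D_h f) x.
pose LL : {linear V -> R} :=
  HB.pack L (GRing.isLinear.Build _ _ _ _ L (radial_mean_linear m Bx)).
rewrite -[LHS]/(LL h) {1}(row_sum_delta h) linear_sum.
by apply: eq_bigr => j _; rewrite linearZ.
Qed.

Lemma radial_mean_ftc x : B x ->
  f x = f x0 + radial_mean x0 0 ('D_(x - x0) f) x.
Proof.
move=> Bx; pose F t := f (seg x0 x t).
have dF t : t \in `[0, 1]%R -> is_derive t 1 F ('D_(x - x0) f (seg x0 x t)).
  by move=> t01; apply: is_derive_line; exact/df/seg_ball.
have sub t : t \in `]0, 1[%R -> t \in `[0, 1]%R by exact: subset_itv_oo_cc.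
have cF t : t \in `[0, 1]%R -> {for t, continuous F}.
  by move=> /dF[/derivable1_diffP/differentiable_continuous].
rewrite /radial_mean /Rintegral.
under eq_integral do rewrite expr0 mul1r.
rewrite (@continuous_FTC2 _ _ F)//.
- by rewrite /= /F /seg scale1r scale0r addr0 subrKC addrC subrK.
- apply: continuous_in_subspaceT => t /[1!inE] t01.
  apply: (@continuous_comp _ _ _ (seg x0 x) ('D_(x - x0) f)).
    apply: cvgD; first exact: cvg_cst.
    by apply: cvgZr_tmp; exact: cvg_id.
  exact/Df/seg_ball.
- split=> [t /sub/dF[]//||].
    by apply: cvg_at_right_filter; apply: cF; rewrite in_itv/= lexx ler01.
  by apply: cvg_at_left_filter; apply: cF; rewrite in_itv/= lexx ler01.
- by move=> t /sub/dF[_]; rewrite derive1E.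
Qed.

(** Differentiation under the integral sign. The remainder is bounded under the
    integral: the mean value theorem turns it into increments of the partial
    derivatives of [f] between two nearby segments, uniformly small in [t]. *)
Lemma radial_mean_differentiable m x : B x ->
  differentiable (radial_mean x0 m f) x /\
  forall v, 'D_v (radial_mean x0 m f) x = radial_mean x0 m.+1 ('D_v f) x.
Proof.
move=> Bx; pose L h := radial_mean x0 m.+1 ('D_h f) x.
pose LL : {linear V -> R} :=
  HB.pack L (GRing.isLinear.Build _ _ _ _ L (radial_mean_linear m.+1 Bx)).
have Lc : continuous LL.
  pose a j := radial_mean x0 m.+1 ('D_(delta_mx ord0 j) f) x.
  have -> : (LL : V -> R) = \sum_j (fun h : V => h ord0 j) * cst (a j).
    by apply/funext => h; rewrite fct_sumE; exact: radial_mean_coord.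
  move=> h; have oT : open (setT : set V) by exact: openT.
  suff /(_ h I) : Ck 0 setT (\sum_j (fun h : V => h ord0 j) * cst (a j)) by [].
  apply: Ck_sum => // j; apply: CkM => //; last exact: Ck_cst.
  exact: Ck_coord oT (@Ck_id _ _ 0 setT).
suff [dm dE] : differentiable (radial_mean x0 m f) x /\
    'd (radial_mean x0 m f) x = LL :> (V -> R).
  by split=> // v; rewrite deriveE// dE.
apply: differentiable_remainder Lc _ => e e0.
have cf y : B y -> {for y, continuous f}.
  by move=> /df/differentiable_continuous.
(* The [n] coordinates of [h] each contribute at most [|h| * e / (n + 1)];
   [n + 1] rather than [n] because [n] may be zero. *)
have e1 : 0 < e / n.+1%:R by rewrite divr_gt0.
have nU : \forall y \near x, forall j t, t \in `[0, 1]%R ->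
    `|'D_(delta_mx ord0 j) f (seg x0 y t) -
      'D_(delta_mx ord0 j) f (seg x0 x t)| < e / n.+1%:R.
  exact: filter_forall (fun j => seg_uniform (@Df (delta_mx ord0 j)) Bx e1).
have nB : \near x, B x.
  by apply: open_nbhs_nbhs; split=> //; exact: ball_open.
have [d /= d0 dU] := (nbhs_ballP x _).1 (filterI nB nU).
near=> h.
have hd : `|h| < d.
  by near: h; exact: (@pseudometric_normed_Zmodule.nbhs0_lt R V d d0).
have hU c : c \in `[0, 1]%R -> ball x d (x + c *: h).
  rewrite -ball_normE in_itv/= => /andP[c0 c1].
  rewrite opprD addrA subrr sub0r normrN normrZ ger0_norm//.
  by apply: le_lt_trans hd; rewrite ler_piMl.
have By : B (h + x).
  have [|+ _] := dU (h + x); last by [].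
  by have := hU 1; rewrite scale1r addrC; apply; rewrite in_itv/= ler01 lexx.
have iy := radial_integrable m cf By.
have ix := radial_integrable m cf Bx.
have iD := radial_integrable m.+1 (@Df h) Bx.
have iyx : mu.-integrable `[0, 1] (EFin \o
    (fun t => t ^+ m * f (seg x0 (h + x) t) - t ^+ m * f (seg x0 x t))).
  have := integrableB _ iy ix.
  by move=> /(_ (measurable_itv _)); apply: eq_integrable.
rewrite /= /L /radial_mean -RintegralB// -RintegralB//.
apply: Rintegral01_le => [|t t01].
  have := integrableB _ iyx iD.
  by move=> /(_ (measurable_itv _)); apply: eq_integrable.
have [t0 t1] : 0 <= t /\ t <= 1.
  by move: t01; rewrite in_itv/= => /andP[].
have segE (c : R) : seg x0 (x + c *: h) t = seg x0 x t + c *: (t *: h).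
  by rewrite /seg addrAC scalerDr scalerA mulrC -scalerA addrA.
have sB (c : R) : c \in `[0, 1]%R -> B (seg x0 x t + c *: (t *: h)).
  move=> c01; rewrite -segE; apply: seg_ball => //.
  by have [] := dU _ (hU _ c01).
have [c c01] := mean_value_line (fun c c01 => df (sB c c01)).
have -> : seg x0 x t + t *: h = seg x0 (h + x) t.
  by rewrite -[t *: h]scale1r -segE scale1r addrC.
set q := seg x0 x t + c *: (t *: h) => fq.
have dq : differentiable f q by exact/df/sB.
have dp : differentiable f (seg x0 x t) by exact/df/seg_ball.
rewrite -mulrBr fq deriveE// linearZ -deriveE//=.
rewrite mulrA -exprSr -mulrBr !derive_coord// -sumrB normrM.
have tm : `|t ^+ m.+1| <= 1 by rewrite ger0_norm ?exprn_ge0// exprn_ile1.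
apply: le_trans (_ : 1 * \sum_(j < n) `|h| * (e / n.+1%:R) <= _).
  apply: ler_pM => //; apply: le_trans (ler_norm_sum _ _ _) _.
  apply: ler_sum => j _; rewrite -mulrBr normrM; apply: ler_pM => //.
    rewrite [leRHS]/Num.Def.normr /= mx_normrE; apply/bigmax_geP; right => /=.
    by exists (ord0, j).
  apply/ltW; rewrite /q -segE.
  by have [_] := dU _ (hU _ c01); apply.
rewrite mul1r sumr_const card_ord -mulrnAr [leRHS]mulrC ler_wpM2l//.
rewrite -[_ *+ n]mulr_natr mulrAC ler_pdivrMr ?ltr0n// ler_wpM2l ?ltW//.
by rewrite ltr_nat.
Unshelve. all: by end_near. Qed.

End C1.

Lemma radial_mean_Ck k m f : Ck k B f -> Ck k B (radial_mean x0 m f).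
Proof.
have oB : open B by exact: ball_open.
elim: k m f => [|k IH] m f.
  by move=> cf x Bx; have := @radial_mean_continuous f m x cf Bx.
move=> [df Df].
have cD v : forall x, B x -> {for x, continuous ('D_v f)}.
  exact: Ck_continuous (Df v).
have H x (Bx : B x) := radial_mean_differentiable df cD m Bx.
split=> [x /H[]//|v]; apply: Ck_eq (IH m.+1 _ (Df v)) => // x /H[_].
by [].
Qed.

(** The fundamental theorem of calculus along segments writes [f x - f x0] as
    the mean of the derivative of [f] in the direction [x - x0]; expanding this
    direction in coordinates produces the factors [g j]. *)
Lemma hadamard f : 0 < r -> smooth_on B f ->
  exists2 g : 'I_n -> V -> R,
    forall j, smooth_on B (g j) /\ g j x0 = 'D_(delta_mx ord0 j) f x0 &
    forall x, B x -> f x = f x0 + \sum_j (x - x0) ord0 j * g j x.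
Proof.
move=> r0 sf; exists (fun j => radial_mean x0 0 ('D_(delta_mx ord0 j) f)).
  move=> j; split.
    by move=> k; apply: radial_mean_Ck; have [_] := sf k.+1; exact.
  rewrite /radial_mean.
  under eq_Rintegral do rewrite expr0 mul1r /seg subrr scaler0 addr0.
  by rewrite Rintegral_cst//= lebesgue_measure_itv/= lte01 oppr0 adde0 mulr1.
have [df Df] := sf 1.
move=> x Bx; rewrite -radial_mean_coord//.
exact: radial_mean_ftc.
Qed.

End OnBall.
End Hadamard.

(** * Point derivations are directional derivatives *)

Section Manifolds.
Local Open Scope classical_set_scope.
Context {R : realType} {n : nat} {M : manifoldType R n}.
Local Notation V := 'rV[R]_n.

Definition zero_extension (c : chart M V) (h : V -> R) (q : M) : R :=
  if `[< dom c q >] then h (coord c q) else 0.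

(** Off the image of [K] in [M] the extension is locally zero, because this
    image is compact, hence closed: this is where [M] has to be Hausdorff. *)
Lemma zero_extension_smooth (c : chart M V) (K U : set V) (h : V -> R) :
  atlas M c -> compact K -> K `<=` U -> open U -> U `<=` crange c ->
  (forall x, ~ K x -> h x = 0) -> smooth_on U h ->
  smooth_fun (zero_extension c h).
Proof.
move=> Ac cK KU oU Uc h0 sh d Ad k; apply/Ck_pointwise => _ [q dq <-].
have [odc _ cKc cc pc] := chartP Ac; have [_ _ dKd _ _] := chartP Ad.
have [[cq Uq]|nq] := pselect (dom c q /\ U (coord c q)).
  pose O := [set p | dom c p /\ U (coord c p)].
  have oO : open O.
    rewrite openE => p [cp Up]; apply: filterI.
      exact: open_nbhs_nbhs.
    by apply: cc => //; exact: open_nbhs_nbhs.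
  have oA : open (coord d @` (dom d `&` O)).
    by apply: chart_image_open => //; exact: chartP.
  suff /Ck_pointwise : Ck k (coord d @` (dom d `&` O))
      (zero_extension c h \o param d) by apply; exists q.
  have [_ _ trans] := @atlasP R n M.
  have ct : Ck k (coord d @` (dom d `&` O)) (coord c \o param d).
    apply: Ck_sub (trans d c Ad Ac k) => _ [p [dp [cp _]] <-].
    by exists p.
  have := @Ck_comp _ _ k _ _ U _ h oA _ (sh k) ct.
  move=> H; apply: Ck_eq (H _) => // _ [p [dp [cp Up]] <-] /=; rewrite dKd//.
  by rewrite /zero_extension asboolT.
pose K' := param c @` K.
have clK : closed K'.
  apply: compact_closed; first exact: manifold_hausdorff.
  apply: continuous_compact => //; apply: continuous_in_subspaceT => x.
  by rewrite inE => Kx; apply: pc; exact/Uc/KU.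
have oA : open (coord d @` (dom d `&` ~` K')).
  by apply: chart_image_open; [exact: chartP|exact: closed_openC].
suff /Ck_pointwise : Ck k (coord d @` (dom d `&` ~` K'))
    (zero_extension c h \o param d).
  apply; exists q => //; split=> // -[x Kx xq]; apply: nq; rewrite -xq.
  have [p cp px] := Uc _ (KU _ Kx).
  by rewrite -px cKc// px; split=> //; exact: KU.
apply: (Ck_eq oA _ (Ck_cst k _ (0 : R))) => _ [p [dp Kp] <-] /=.
rewrite dKd// /zero_extension; case: asboolP => // cp.
rewrite h0// => Kx; apply: Kp; exists (coord c p) => //; exact: cKc.
Qed.

Lemma Cinf_mulE (f g : Cinf M) q : (f * g) q = f q * g q.
Proof. by []. Qed.

Lemma Cinf_sumE m (F : 'I_m -> Cinf M) q : (\sum_j F j) q = \sum_j F j q.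
Proof. by elim/big_rec2 : _ => // j a b _ <-. Qed.

Section Derivation.
Variables (p : M) (v : Cinf M -> R).
Hypothesis dv : point_derivation p v.

Lemma derivationD f g : v (f + g) = v f + v g.
Proof. by have [lv _] := dv; have := lv 1 f g; rewrite scale1r mul1r. Qed.

Lemma derivation0 : v 0 = 0.
Proof. by apply: (addrI (v 0)); rewrite -derivationD !addr0. Qed.

Lemma derivationZ a f : v (a *: f) = a * v f.
Proof.
by have [lv _] := dv; have := lv a f 0; rewrite addr0 derivation0 addr0.
Qed.

Lemma derivation_sum m (F : 'I_m -> Cinf M) : v (\sum_j F j) = \sum_j v (F j).
Proof. by apply: (big_morph v derivationD derivation0). Qed.

Lemma derivation1 : v 1 = 0.
Proof.
have [_ /(_ 1 1)] := dv; rewrite mulr1 -[(1 : Cinf M) p]/(1 : R) mulr1 mul1r.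
by move/eqP; rewrite -subr_eq subrr => /eqP.
Qed.

(** With a bump function [b] at [p] supported in the chart, Hadamard's lemma
    gives [b^2 (f - f p) = sum_j (b (x_j - x_j(p))) (b g_j)], an identity
    between globally defined smooth functions. The derivation [v] turns its
    left-hand side into [v f] and its right-hand side into a combination, with
    coefficients independent of [f], of the partial derivatives
    [g_j (x(p)) = D_j f]. *)
Lemma point_derivation_chart (c : chart M V) : atlas M c -> dom c p ->
  exists w : V, forall f : Cinf M, v f = 'D_w (f \o param c) (coord c p).
Proof.
move=> Ac cp; pose x0 := coord c p.
have [_ oc cK _ _] := chartP Ac.
have [rho /= rho0 rhoc] : exists2 rho : R, 0 < rho & ball x0 rho `<=` crange c.
  by apply/nbhs_ballP; apply: open_nbhs_nbhs; split=> //; exists p.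
(* Half the radius: the closed cube that supports [b] must lie in the open
   ball on which Hadamard's lemma is applied. *)
have r0 : 0 < rho / 2 by rewrite divr_gt0.
have [b [sb b1 bK]] := bump x0 r0.
pose I j := `[x0 ord0 j - rho / 2, x0 ord0 j + rho / 2]%classic.
pose K := [set x : V | forall j, I j (x ord0 j)].
have cptK : compact K.
  by apply: (@rV_compact _ _ I) => j; exact: segment_compact.
have bK0 x : ~ K x -> b x = 0.
  move=> nK; apply: contrapT => /eqP /bK H; apply: nK => j.
  by rewrite /I /= in_itv/= -ler_distl.
have KB : K `<=` ball x0 rho.
  move=> x Kx; split=> // i j; rewrite (ord1 i).
  have := Kx j; rewrite /I /= in_itv/= -ler_distl distrC => H.
  rewrite /ball /=; apply: le_lt_trans H _.
  by rewrite gtr_pMr// invf_lt1 ?ltr1n.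
have oB : open (ball x0 rho) by exact: ball_open.
have sE (h : V -> R) : smooth_on (ball x0 rho) h ->
    smooth_fun (zero_extension c (b * h)).
  move=> sh; apply: (zero_extension_smooth Ac cptK KB oB rhoc) => //.
    by move=> x /bK0; rewrite !fctE => ->; rewrite mul0r.
  by move=> k; apply: (CkM oB) (Ck_sub (@subsetT _ _) (sb k)) (sh k).
pose E h sh : Cinf M := mkCinf (sE h sh).
have Eout h sh q : ~ dom c q -> E h sh q = 0.
  by move=> cq; rewrite /E /= /zero_extension asboolF.
have Ein h sh q : dom c q -> E h sh q = b (coord c q) * h (coord c q).
  by move=> cq; rewrite /E /= /zero_extension asboolT.
have Ep h sh : E h sh p = h x0.
  by rewrite Ein// b1 mul1r.
have s1 : smooth_on (ball x0 rho) (cst 1 : V -> R) by move=> k; exact: Ck_cst.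
have sx j : smooth_on (ball x0 rho) (fun x : V => (x - x0) ord0 j).
  move=> k; apply: (Ck_coord _ oB); apply: (CkD oB (Ck_id k _)).
  exact: Ck_cst.
pose w : V := \row_j v (E _ (sx j)).
exists w => f.
have sf : smooth_on (ball x0 rho) (f \o param c).
  by move=> k; apply: Ck_sub rhoc _; exact: CinfP.
have [g gP fE] := hadamard rho0 sf.
have sg j := (gP j).1.
pose B := E _ s1.
have BE : B * B * (f + (- f p) *: (1 : Cinf M)) =
    \sum_j E _ (sx j) * E _ (sg j).
  apply/val_inj/funext => q; rewrite [RHS]Cinf_sumE.
  transitivity (B q * B q * (f q + - f p * 1)); first by [].
  have [cq|cq] := pselect (dom c q); last first.
    by rewrite /B Eout// !mul0r big1// => j _; rewrite Cinf_mulE Eout// mul0r.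
  rewrite mulr1 /B Ein// mulr1.
  transitivity (b (coord c q) * b (coord c q) *
      \sum_j (coord c q - x0) ord0 j * g j (coord c q)); last first.
    rewrite mulr_sumr; apply: eq_bigr => j _.
    by rewrite Cinf_mulE !Ein//; ring.
  have [Kq|/bK0->] := pselect (K (coord c q)); last by rewrite !mul0r.
  have := fE _ (KB _ Kq); rewrite /= cK// /x0 cK// => ->.
  by rewrite addrC addKr.
have := congr1 v BE; have [lv dvM] := dv.
rewrite dvM derivation_sum.
rewrite -[(B * B) p]/(B p * B p) -[(f + _) p]/(f p + - f p * 1) Ep.
rewrite mulr1 subrr mulr0 add0r.
rewrite mulr1 mul1r derivationD derivationZ derivation1 mulr0 addr0 => ->.
have [df _] := sf 1.
rewrite derive_coord; last by apply: df; exact: ballxx.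
apply: eq_bigr => j _; rewrite dvM !Ep subrr mxE mul0r addr0 mxE.
by rewrite (gP j).2.
Qed.

End Derivation.
End Manifolds.

(** * Smooth maps into a Lie group *)

Section SmoothMaps.
Local Open Scope classical_set_scope.
Context {R : realType}.

Lemma near_param {n} {M : manifoldType R n} (c : chart M 'rV[R]_n) (p : M)
    (P : set M) : atlas M c -> dom c p -> nbhs p P ->
  \forall x \near coord c p, P (param c x).
Proof.
move=> Ac cp; have [_ _ cK _ pc] := chartP Ac.
by rewrite -{1}(cK p cp) => nP; apply: pc nP; exists p.
Qed.

Lemma smooth_map_id n (M : manifoldType R n) : smooth_map (@id M).
Proof.
split=> [x|c d Ac Ad]; first exact: cvg_id.
by have [_ _] := @atlasP R n M; exact.
Qed.

Lemma smooth_map_comp m n p (M : manifoldType R m) (N : manifoldType R n)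
    (P : manifoldType R p) (F : M -> N) (H : N -> P) :
  smooth_map F -> smooth_map H -> smooth_map (H \o F).
Proof.
move=> [cF sF] [cH sH]; split=> [x|c d Ac Ad k].
  by apply: continuous_comp; [exact: cF|exact: cH].
apply/Ck_pointwise => _ [q [cq dq] <-].
have [b Ab bq] := chart_at (F q).
have [_ _ cK _ _] := chartP Ac; have [ob _ bK _ _] := chartP Ab.
have [od _ _ _ _] := chartP Ad.
have oHd : open (H @^-1` dom d) by apply: open_comp od => x _; exact: cH.
have oB : open (coord b @` (dom b `&` H @^-1` dom d)).
  by apply: chart_image_open => //; exact: chartP.
have oA : open (coord c @` (dom c `&` F @^-1` (dom b `&` H @^-1` dom d))).
  apply: chart_image_open; first exact: chartP.
  by apply: open_comp (openI ob oHd) => x _; exact: cF.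
suff /Ck_pointwise : Ck k
    (coord c @` (dom c `&` F @^-1` (dom b `&` H @^-1` dom d)))
    (coord d \o (H \o F) \o param c) by apply; exists q.
have cFk : Ck k (coord c @` (dom c `&` F @^-1` (dom b `&` H @^-1` dom d)))
    (coord b \o F \o param c).
  by apply: Ck_sub (sF c b Ac Ab k) => _ [p' [cp' [bp' _]] <-]; exists p'.
have := Ck_comp_row oA oB _ (sH b d Ab Ad k) cFk.
move=> H'; apply: Ck_eq (H' _) => //.
  by move=> _ [p' [cp' [bp' dp']] <-] /=; rewrite cK// bK.
by move=> _ [p' [cp' [bp' dp']] <-]; exists (F p') => //=; rewrite cK.
Qed.

Section Group.
Context {n : nat} {G : lieGroupType R n}.

Lemma mul_continuous : continuous (fun p : G * G => (p.1 * p.2)%g).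
Proof. by have [] := @mul_smooth R n G. Qed.

(** Coordinates, in the charts [a] and [b], of the pairs whose product lies in
    the domain of [d]: here the multiplication reads as a map of row spaces. *)
Definition mul_dom (a b d : chart G 'rV[R]_n) : set ('rV[R]_n * 'rV[R]_n) :=
  coord (prod_chart a b) @`
    (dom (prod_chart a b) `&` (fun p : G * G => (p.1 * p.2)%g) @^-1` dom d).

Lemma mul_dom_open a b d : atlas G a -> atlas G b -> atlas G d ->
  open (mul_dom a b d).
Proof.
move=> Aa Ab Ad; rewrite openE => _ [[g h] [[/= ag bh] /= dgh] <-] /=.
have [od _ _ _ _] := chartP Ad.
have [_ oa _ _ _] := chartP Aa; have [_ ob _ _ _] := chartP Ab.
have [[P Q] [/= nP nQ] PQ] :
    nbhs (g, h) ((fun p : G * G => (p.1 * p.2)%g) @^-1` dom d).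
  by apply: mul_continuous; exact: open_nbhs_nbhs.
exists (crange a `&` param a @^-1` P, crange b `&` param b @^-1` Q) => /=.
  split; apply: filterI.
  - by apply: open_nbhs_nbhs; split=> //; exists g.
  - exact: near_param nP.
  - by apply: open_nbhs_nbhs; split=> //; exists h.
  - exact: near_param nQ.
move=> [_ _] [/= [[g' ag' <-] Pg'] [[h' bh' <-] Qh']].
have [_ _ aK _ _] := chartP Aa; have [_ _ bK _ _] := chartP Ab.
exists (g', h') => //; split=> //.
apply: (PQ (g', h')); split=> /=; first by rewrite -(aK _ ag').
by rewrite -(bK _ bh').
Qed.

Lemma smooth_map_mul m (M : manifoldType R m) (F H : M -> G) :
  smooth_map F -> smooth_map H -> smooth_map (fun x => (F x * H x)%g).
Proof.
move=> [cF sF] [cH sH].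
have cFH : continuous (fun x => (F x * H x)%g).
  move=> x; apply: (@continuous_comp _ _ _ (fun x => (F x, H x))
    (fun p : G * G => (p.1 * p.2)%g)); last exact: mul_continuous.
  exact: cvg_pair (cF x) (cH x).
split=> // c d Ac Ad k; apply/Ck_pointwise => _ [q [cq dq] <-].
have [a Aa aq] := chart_at (F q); have [b Ab bq] := chart_at (H q).
have [oa _ aK _ _] := chartP Aa; have [ob _ bK _ _] := chartP Ab.
have [_ _ cK _ _] := chartP Ac; have [od _ _ _ _] := chartP Ad.
pose O := F @^-1` dom a `&` (H @^-1` dom b `&`
  (fun x => (F x * H x)%g) @^-1` dom d).
have oO : open O.
  apply: openI; first by apply: open_comp oa => x _; exact: cF.
  apply: openI; first by apply: open_comp ob => x _; exact: cH.
  by apply: open_comp od => x _; exact: cFH.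
have oA : open (coord c @` (dom c `&` O)).
  by apply: chart_image_open => //; exact: chartP.
suff /Ck_pointwise : Ck k (coord c @` (dom c `&` O))
    (coord d \o (fun x => (F x * H x)%g) \o param c) by apply; exists q.
have c1 : Ck k (coord c @` (dom c `&` O)) (coord a \o F \o param c).
  by apply: Ck_sub (sF c a Ac Aa k) => _ [p' [cp' [? _]] <-]; exists p'.
have c2 : Ck k (coord c @` (dom c `&` O)) (coord b \o H \o param c).
  by apply: Ck_sub (sH c b Ac Ab k) => _ [p' [cp' [_ [? _]]] <-]; exists p'.
have [_ sm] := @mul_smooth R n G.
have Aab : prod_atlas (atlas G) (atlas G) (prod_chart a b).
  by exists a => //; exists b.
have := Ck_comp2_row oA (mul_dom_open Aa Ab Ad) _ (sm _ _ Aab Ad k) c1 c2.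
move=> H'; apply: Ck_eq (H' _) => //.
  by move=> _ [p' [cp' [ap' [bp' dp']]] <-] /=; rewrite cK// aK// bK.
move=> _ [p' [cp' [ap' [bp' dp']]] <-] /=; rewrite cK//.
by exists (F p', H p').
Qed.

(** Contrary to the multiplication, whose coordinate expression is only defined
    where the product stays in a chart, a scalar function of the product is
    smooth on the whole product of two chart ranges. *)
Lemma mul_chart_smooth (a b : chart G 'rV[R]_n) (f : Cinf G) :
  atlas G a -> atlas G b ->
  smooth_on (crange a `*` crange b)
    (fun z => f (param a z.1 * param b z.2)%g).
Proof.
move=> Aa Ab k; apply/Ck_pointwise => -[_ _] [/= [g ag <-] [h bh <-]].
have [_ _ aK _ _] := chartP Aa; have [_ _ bK _ _] := chartP Ab.
have [d Ad dgh] := chart_at (g * h)%g.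
have [_ _ dK _ _] := chartP Ad.
have oA := mul_dom_open Aa Ab Ad.
suff /Ck_pointwise : Ck k (mul_dom a b d)
    (fun z => f (param a z.1 * param b z.2)%g) by apply; exists (g, h).
have [_ sm] := @mul_smooth R n G.
have Aab : prod_atlas (atlas G) (atlas G) (prod_chart a b).
  by exists a => //; exists b.
have H' := @Ck_comp _ _ k _ _ (crange d) _ _ oA _ (CinfP f Ad k)
  (sm _ _ Aab Ad k).
apply: Ck_eq (H' _) => // _ [[g' h'] [[/= ag' bh'] /= dgh'] <-] /=.
  by rewrite aK// bK// dK.
by rewrite aK// bK//; exists (g' * h')%g.
Qed.

End Group.
End SmoothMaps.

(** * The Lie algebra of a Lie group *)

Section LiePart.
Local Open Scope classical_set_scope.
Context {R : realType} {n : nat} {G : lieGroupType R n}.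

(** The differential of the multiplication at [(1, 1)] is the addition: moving
    one factor while the other one stays at [1] gives back the moving factor. *)
Lemma derivation_mul m (M : manifoldType R m) (p : M) (v : Cinf M -> R)
    (F H : M -> G) (sF : smooth_map F) (sH : smooth_map H)
    (sFH : smooth_map (fun x => (F x * H x)%g)) (f : Cinf G) :
  point_derivation p v -> F p = 1%g -> H p = 1%g ->
  v (pullback sFH f) = v (pullback sF f) + v (pullback sH f).
Proof.
move=> dv Fp Hp.
have [c Ac cp] := chart_at p; have [e Ae e1] := chart_at (1%g : G).
have [w vw] := point_derivation_chart dv Ac cp.
have [_ _ cK _ _] := chartP Ac; have [oe oce eK _ _] := chartP Ae.
pose Phi z := f (param e z.1 * param e z.2)%g.
pose Fl := coord e \o F \o param c; pose Hl := coord e \o H \o param c.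
have dl K (sK : smooth_map K) : K p = 1%g ->
    differentiable (coord e \o K \o param c) (coord c p).
  move=> Kp; have [_ sK'] := sK; have [+ _] := sK' c e Ac Ae 1.
  by apply; exists p => //; split=> //=; rewrite Kp.
have ne K (sK : smooth_map K) : K p = 1%g ->
    \forall x \near coord c p, dom e (K (param c x)).
  move=> Kp; have [cK' _] := sK.
  apply: (near_param (P := fun q => dom e (K q)) Ac cp); apply: cK'.
  by apply: open_nbhs_nbhs; split=> //=; rewrite Kp.
have Flp : Fl (coord c p) = coord e 1%g by rewrite /Fl /= cK// Fp.
have Hlp : Hl (coord c p) = coord e 1%g by rewrite /Hl /= cK// Hp.
have dPhi : differentiable Phi (Fl (coord c p), Hl (coord c p)).
  have [+ _] := mul_chart_smooth f Ae Ae 1; apply.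
  by rewrite Flp Hlp; split; exists 1%g.
have := derive_pair_split w (dl F sF Fp) (dl H sH Hp) dPhi.
rewrite !vw; congr (_ = _ + _); apply: near_eq_derive.
- near=> x; rewrite /Phi /= !eK//; first by near: x; exact: ne.
  by near: x; exact: ne.
- near=> x; rewrite /Phi /= cK// Hp !eK// ?mulg1//.
  by near: x; exact: ne.
- near=> x; rewrite /Phi /= cK// Fp !eK// ?mul1g//.
  by near: x; exact: ne.
Unshelve. all: by end_near. Qed.

Lemma tangent_ext m (M : manifoldType R m) (p : M) (u v : tangent_space p) :
  (forall f, u f = v f) -> u = v.
Proof.
case: u v => [u du] [v dv] /= uv.
have {}uv : u = v by apply/funext.
by rewrite uv in du *; congr MkTangent; exact: Prop_irrelevance.
Qed.

Lemma lie_ext (X Y : lie_algebra G) : (forall f, X f 1%g = Y f 1%g) -> X = Y.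
Proof. by move=> XY; apply: lie_at1_inj; exact: tangent_ext. Qed.

(** In charts [v] is a directional derivative, so the value at [g] is a partial
    derivative in the second variable of the smooth function [f (g * h)]. *)
Lemma translate_smooth (v : Cinf G -> R) (f : Cinf G) :
  point_derivation (1%g : G) v ->
  smooth_fun (fun g => v (pullback (smooth_mulg g) f)).
Proof.
move=> dv; have [e Ae e1] := chart_at (1%g : G).
have [w vw] := point_derivation_chart dv Ae e1.
move=> a Aa k; set x1 := coord e 1%g.
pose Phi z := f (param a z.1 * param e z.2)%g.
have [_ oa aK _ _] := chartP Aa; have [_ oe _ _ _] := chartP Ae.
have [_ /(_ (0, w))] := mul_chart_smooth f Aa Ae k.+1.
rewrite -/Phi => cPhi.
have dh x : is_diff x (fun y : 'rV[R]_n => (y, x1)) (fun v => (v, 0)).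
  exact: is_diff_pair.
have H := Ck_comp_affine oa dh _ cPhi.
apply: Ck_eq (H _) => // [x _|x ax]; last by split=> //; exists 1%g.
by rewrite /= vw -(derive_slice Phi).
Qed.

(** The field consists of the left translates of [v]. *)
Lemma left_invariant_extension (v : Cinf G -> R) :
  point_derivation (1%g : G) v ->
  exists X : lie_algebra G, forall f, X f 1%g = v f.
Proof.
move=> dv; pose X f : Cinf G := mkCinf (translate_smooth f dv).
have [lv dvM] := dv.
have Xl : left_invariant_field X.
  split=> [a f g|f g|a f]; apply/val_inj/funext => x.
  - rewrite -[RHS]/(a * v (pullback (smooth_mulg x) f) +
      v (pullback (smooth_mulg x) g)) -lv.
    by congr (v _); exact: val_inj.
  - rewrite -[RHS]/(v (pullback (smooth_mulg x) f) * g x +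
      f x * v (pullback (smooth_mulg x) g)).
    have := dvM (pullback (smooth_mulg x) f) (pullback (smooth_mulg x) g).
    by rewrite /= !mulg1 => <-; congr (v _); exact: val_inj.
  - rewrite /=; congr (v _); apply/val_inj/funext => y /=.
    by rewrite mulgA.
exists (MkLie (asboolT Xl)) => f /=.
by congr (v _); apply/val_inj/funext => y /=; rewrite mul1g.
Qed.

Lemma lie_at_surj (v : tangent_space (1%g : G)) :
  exists X : lie_algebra G, lie_at 1%g X = v.
Proof.
have [X Xv] := left_invariant_extension (tangentP v).
by exists X; apply: tangent_ext.
Qed.

(** The tangent map of [F] at [1], transported to [lie_algebra G] by the
    identification with the tangent space at [1]; [F] need not be a group
    morphism, so this cannot be a pushforward of vector fields. *)
Definition lie_push (F : G -> G) (sF : smooth_map F) (F1 : F 1%g = 1%g)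
    (X : lie_algebra G) : lie_algebra G :=
  projT1 (cid (lie_at_surj (tangent_map sF F1 (lie_at 1%g X)))).

Lemma lie_at_push F sF F1 X :
  lie_at 1%g (@lie_push F sF F1 X) = tangent_map sF F1 (lie_at 1%g X).
Proof. by rewrite /lie_push; case: cid. Qed.

Lemma lie_pushE F sF F1 X f :
  @lie_push F sF F1 X f 1%g = X (pullback sF f) 1%g.
Proof.
have := congr1 (fun v : tangent_space (1%g : G) => v f) (lie_at_push sF F1 X).
by [].
Qed.

Lemma lie_push_linear F sF F1 : linear (@lie_push F sF F1).
Proof.
move=> a X Y; apply: lie_ext => f.
rewrite -[RHS]/(a * lie_push sF F1 X f 1%g + lie_push sF F1 Y f 1%g).
by rewrite !lie_pushE.
Qed.

Lemma lie_push_mul F sF F1 H sH H1 sFH FH1 X :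
  @lie_push (fun x => (F x * H x)%g) sFH FH1 X =
  @lie_push F sF F1 X + @lie_push H sH H1 X.
Proof.
apply: lie_ext => f.
rewrite -[RHS]/(lie_push sF F1 X f 1%g + lie_push sH H1 X f 1%g) !lie_pushE.
exact: (derivation_mul sF sH sFH f (lie_at_subproof 1%g X) F1 H1).
Qed.

Lemma lie_push_id s1 e1 X : @lie_push id s1 e1 X = X.
Proof.
by apply: lie_ext => f; rewrite lie_pushE; congr (X _ _); exact: val_inj.
Qed.

Lemma lie_push_inv sV V1 X : @lie_push (fun g => g^-1)%g sV V1 X = - X.
Proof.
have si := smooth_map_id G.
(* The product of the inverse and the identity is constant, so its tangent map
   is zero. *)
have sc := smooth_map_mul sV si.
have c1 : (1^-1 * 1 = 1 :> G)%g by rewrite mulVg.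
apply/eqP; rewrite -addr_eq0 -{2}(lie_push_id si erefl X).
rewrite -(lie_push_mul sV V1 si erefl sc c1).
apply/eqP/lie_ext => f; rewrite lie_pushE.
have -> : pullback sc f = f 1%g *: (1 : Cinf G).
  by apply/val_inj/funext => x /=; rewrite mulVg [RHS]mulr1.
have dX := lie_at_subproof 1%g X.
by rewrite (derivationZ dX) (derivation1 dX) mulr0.
Qed.

Lemma lie_push_comp F sF F1 H sH H1 sHF HF1 X :
  @lie_push (H \o F) sHF HF1 X = @lie_push H sH H1 (@lie_push F sF F1 X).
Proof.
by apply: lie_ext => f; rewrite !lie_pushE; congr (X _ _); exact: val_inj.
Qed.

(** For a group morphism [F], left-invariance makes a field [F]-related to its
    push at every point and not only at [1], and brackets of related fields are
    related. *)
Lemma lie_push_hom F sF F1 : (forall g h : G, F (g * h) = F g * F h)%g ->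
  forall X Y, @lie_push F sF F1 (lie_bracket X Y) =
    lie_bracket (lie_push sF F1 X) (lie_push sF F1 Y).
Proof.
move=> FM X Y.
have rel (Z : lie_algebra G) f :
    Z (pullback sF f) = pullback sF (lie_push sF F1 Z f).
  apply/val_inj/funext => g /=.
  have [_ _ iZ] := lie_fieldP Z; have [_ _ iP] := lie_fieldP (lie_push sF F1 Z).
  have := lie_pushE sF F1 Z (pullback (smooth_mulg (F g)) f).
  rewrite iP /= mulg1 => ->.
  have -> : pullback sF (pullback (smooth_mulg (F g)) f) =
            pullback (smooth_mulg g) (pullback sF f).
    by apply/val_inj/funext => h /=; rewrite FM.
  by rewrite iZ /= mulg1.
apply: lie_ext => f; rewrite lie_pushE /=.
rewrite -[LHS]/(X (Y (pullback sF f)) 1%g - Y (X (pullback sF f)) 1%g).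
by rewrite !rel /= F1.
Qed.

Lemma lie_bracket_laws : is_lie_bracket (@lie_bracket R n G).
Proof.
have fD (X : lie_algebra G) f g : X (f + g) = X f + X g.
  by have [lX _ _] := lie_fieldP X; have := lX 1 f g; rewrite !scale1r.
have fZ (X : lie_algebra G) a f : X (a *: f) = a *: X f.
  have [lX _ _] := lie_fieldP X; have X0 : X 0 = 0.
    by apply: (addrI (X 0)); rewrite -fD !addr0.
  by have := lX a f 0; rewrite X0 !addr0.
have fN (X : lie_algebra G) f : X (- f) = - X f.
  by rewrite -[in LHS]scaleN1r fZ scaleN1r.
split.
- move=> Z a X Y; apply/val_inj/funext => f.
  rewrite -[LHS]/((a *: X (Z f) + Y (Z f)) - Z (a *: X f + Y f)).
  rewrite -[RHS]/(a *: (X (Z f) - Z (X f)) + (Y (Z f) - Z (Y f))).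
  by rewrite fD fZ scalerBr opprD addrACA.
- move=> Z a X Y; apply/val_inj/funext => f.
  rewrite -[LHS]/(Z (a *: X f + Y f) - (a *: X (Z f) + Y (Z f))).
  rewrite -[RHS]/(a *: (Z (X f) - X (Z f)) + (Z (Y f) - Y (Z f))).
  by rewrite fD fZ scalerBr opprD addrACA.
- by move=> X; apply/val_inj/funext => f; exact: subrr.
move=> X Y Z; apply/val_inj/funext => f.
rewrite -[LHS]/(X (Y (Z f) - Z (Y f)) - (Y (Z (X f)) - Z (Y (X f))) +
  (Y (Z (X f) - X (Z f)) - (Z (X (Y f)) - X (Z (Y f)))) +
  (Z (X (Y f) - Y (X f)) - (X (Y (Z f)) - Y (X (Z f))))).
rewrite !fD !fN; apply/val_inj/funext => x.
rewrite -[LHS]/(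
  (X (Y (Z f)) x - X (Z (Y f)) x - (Y (Z (X f)) x - Z (Y (X f)) x)) +
  (Y (Z (X f)) x - Y (X (Z f)) x - (Z (X (Y f)) x - X (Z (Y f)) x)) +
  (Z (X (Y f)) x - Z (Y (X f)) x - (X (Y (Z f)) x - Y (X (Z f)) x))).
rewrite -[RHS]/(0 : R); ring.
Qed.

(** * Differential operators *)

(** If [F] has weight [1] then [P g = F g * g] is a group morphism. Its tangent
    map is the one of [F] plus the identity and preserves brackets; expanding
    [(F' + id) [X, Y] = [(F' + id) X, (F' + id) Y]], where [F'] is the tangent
    map of [F], and cancelling [[X, Y]] is the claim. *)
Lemma lie_push_weight1 F sF F1 :
  (forall g h : G, F (g * h) = F g * Ad g (F h))%g ->
  differential_lie_algebra 1 lie_bracket (@lie_push F sF F1).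
Proof.
move=> FM; have brl := lie_bracket_laws.
split=> //; first exact: lie_push_linear.
have si := smooth_map_id G.
pose P g := (F g * g)%g.
have P1 : P 1%g = 1%g by rewrite /P F1 mulg1.
have sP : smooth_map P by exact: smooth_map_mul.
have PM g h : P (g * h)%g = (P g * P h)%g.
  by rewrite /P FM /Ad !mulgA mulgVK.
move=> X Y; have := lie_push_hom sP P1 PM X Y.
have PE Z : lie_push sP P1 Z = lie_push sF F1 Z + Z.
  by rewrite (lie_push_mul sF F1 si erefl) lie_push_id.
rewrite !PE scale1r; have [brL brR _ _] := brl.
have DL (A B C : lie_algebra G) :
    lie_bracket (A + B) C = lie_bracket A C + lie_bracket B C.
  by have := brL C 1 A B; rewrite !scale1r.
have DR (A B C : lie_algebra G) :
    lie_bracket A (B + C) = lie_bracket A B + lie_bracket A C.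
  by have := brR A 1 B C; rewrite !scale1r.
rewrite !DL !DR [X in _ = X]addrA => /addIr->.
by rewrite [RHS]addrC addrA.
Qed.

End LiePart.

Lemma differential_lie_algebra_opp (K : fieldType) (L : lmodType K)
    (br : L -> L -> L) (S : L -> L) : differential_lie_algebra 1 br S ->
  differential_lie_algebra (-1) br (fun x => - S x).
Proof.
move=> [brP lS SB]; have [brL brR _ _] := brP; split=> // [a u v|u v].
  by rewrite lS opprD scalerN.
have linN (h : L -> L) : linear h -> forall x, h (- x) = - h x.
  move=> lh x; have hD a b : h (a + b) = h a + h b.
    by have := lh 1 a b; rewrite !scale1r.
  have h0 : h 0 = 0 by apply: (addrI (h 0)); rewrite -hD !addr0.
  by apply/eqP; rewrite -addr_eq0 -hD addNr h0.
have NL x y : br (- x) y = - br x y by exact: (linN (br^~ y)).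
have NR x y : br x (- y) = - br x y by exact: linN.
by rewrite SB !NL !NR opprK scale1r scaleN1r !opprD.
Qed.

Lemma rota_baxter_inverse (R : realType) (n : nat) (G : lieGroupType R n)
    (eps : R) (B D : G -> G) : smooth_map D -> rota_baxter_operator eps B ->
  cancel B D -> cancel D B -> differential_operator eps D.
Proof.
move=> sD [_ rb] BK DK; split=> //; case: rb => -[eps1 rb]; [left|right];
  split=> // g h; have := rb (D g) (D h); rewrite !DK => ->; exact: BK.
Qed.

Theorem theorem2p18 (R : realType) (n : nat) (G : lieGroupType R n) (eps : R)
    (heps : eps = 1 \/ eps = -1) :
  (forall DD : G -> G, smooth_map DD ->
    (exists BB : G -> G,
      [/\ rota_baxter_operator eps BB, cancel BB DD & cancel DD BB]) ->
    differential_operator eps DD) /\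
  (forall (DD : G -> G) (hDD : differential_operator eps DD),
    exists D : lie_algebra G -> lie_algebra G,
      (forall X, lie_at 1%g (D X) = tangent_at1 hDD (lie_at 1%g X)) /\
      differential_lie_algebra eps lie_bracket D).
Proof.
split=> [DD sDD [BB [rb BK DK]]|DD hDD].
  exact: rota_baxter_inverse rb BK DK.
have sD := differential_operator_smooth hDD.
have D1 := differential_operator1 hDD.
exists (lie_push sD D1); split=> [X|].
  rewrite lie_at_push; apply: tangent_ext => f /=.
  by congr (X _ _); exact: val_inj.
have [_ [[-> DM]|[-> DM]]] := hDD; first exact: lie_push_weight1.
have sV := @inv_smooth R n G; have V1 : (1^-1 = 1 :> G)%g by exact: invg1.
pose I := (fun g : G => g^-1)%g \o DD.
have sI : smooth_map I by exact: smooth_map_comp.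
have I1 : I 1%g = 1%g by rewrite /I /= D1.
have IM g h : (I (g * h) = I g * Ad g (I h))%g.
  by rewrite /I /= DM /Ad !invgM invgK !mulgA.
rewrite (_ : lie_push sD D1 = fun X => - lie_push sI I1 X); last first.
  apply/funext => X.
  by rewrite (lie_push_comp sD D1 sV V1) lie_push_inv opprK.
exact/differential_lie_algebra_opp/lie_push_weight1.
Qed.
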